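(* For any real $A\ge 1$ and any $\epsilon>0$, the following hold (as $x\to\infty$): (1) $|\overline{\mathbb{S}_k^3(x,A)}|=O_{A,\epsilon}(x^{1-\frac1A+\epsilon})$ for every integer $k\ge 6$; (2) $|\overline{\mathbb{S}_k^4(x,A)}|=O_{A,\epsilon}(x^{1-\frac1A+\epsilon})$ for every integer $k\ge 18$; (3) $|\overline{\mathbb{S}_k^r(x,A)}|=O_{A,\epsilon}(x^{1-\frac1A+\epsilon})$ for every integer $r\ge 5$ and every $k\in\mathbb{N}$. In particular, (1') for $k\ge 6$, $\lim_{x\to\infty}\frac{|\overline{\mathbb{S}_k^3(x,A)}|}{x}=0$; (2') for $k\ge 18$, $\lim_{x\to\infty}\frac{|\overline{\mathbb{S}_k^4(x,A)}|}{x}=0$; (3') for $r\ge 5$ and any $k\in\mathbb{N}$, $\lim_{x\to\infty}\frac{|\overline{\mathbb{S}_k^r(x,A)}|}{x}=0$.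
   Context: $\mathbb{N}$ denotes the positive integers. $C_n$ is the cyclic group of order $n$ and $C_n^r$ is the direct sum of $r$ copies of it (exponent $n$). A sequence over a finite abelian group $G$ is a finite unordered sequence of elements of $G$ with repetition allowed; its length is the number of terms counted with multiplicity, a subsequence is a sub-multiset, and a sequence is zero-sum if its terms sum to $0$. For a finite abelian group $G$ with exponent $m$ and $k\in\mathbb{N}$, $\mathsf{s}_{km}(G)$ is the smallest positive integer $t$ such that every sequence over $G$ of length at least $t$ has a zero-sum subsequence of length exactly $km$; $\mathsf{s}(G)=\mathsf{s}_m(G)$. For $n\ge 2$, $\mathsf{M}(n)$ is the largest prime power divisor of $n$. If $\mathsf{M}(n)=p^a$ with $p$ prime, then $\mathsf{p}(n,r)=\min\{p^t : t\in\mathbb{N},\ p^t\ge r\}$. Constant $a_r$: by a theorem of Alon and Dubiner there is an absolute constant $c>0$ such that $\mathsf{s}(C_n^r)\le (cr\log_2 r)^r n$ for all $n\in\mathbb{N}$ and $r\ge 2$. Fix such a $c$ and put $a_r=(cr\log_2 r)^r-r$. For $r\in\{3,4\}$ let $$\mathbb{S}_k^r(x,A)=\left\{2\le n\le x : \mathsf{s}_{kn}(C_n^r)\le (k+r)n+a_r\frac{n}{(\ln n)^A}\right\},$$ and for $r\ge 5$ let $$\mathbb{S}_k^r(x,A)=\left\{2\le n\le x : \mathsf{s}_{k\mathsf{p}(n,r)n}(C_n^r)\le (k\,\mathsf{p}(n,r)+r)n+a_r\frac{n}{(\ln n)^A}\right\}.$$ In all cases $\overline{\mathbb{S}_k^r(x,A)}=\{n\in\mathbb{N}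 : n\le x,\ n\notin\mathbb{S}_k^r(x,A)\}$. $f(x)=O_{A,\epsilon}(g(x))$ means there exist a real $M>0$ depending on $A$ and $\epsilon$, and a positive integer $x_0$, such that $|f(x)|\le M|g(x)|$ for all $x\ge x_0$. *)

(* Defs.v *)
From mathcomp Require Import all_boot all_order all_algebra all_fingroup.
From mathcomp Require Import abelian finmap.
From mathcomp Require Import all_classical all_reals all_analysis.
Set Implicit Arguments.
Unset Strict Implicit.
Unset Printing Implicit Defensive.
Import Order.TTheory GRing.Theory Num.Theory.
Import numFieldNormedType.Exports.
Local Open Scope classical_set_scope.
Local Open Scope ring_scope.

(* The least element of a nonempty set of natural numbers (0 by convention if
   the set is empty; the lemmas below show that this case does not occur). *)
Definition least (P : set nat) : nat :=
  xget 0%N [set m | P m /\ forall i, P i -> (m <= i)%N].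

Lemma leastP (P : set nat) : P !=set0 ->
  P (least P) /\ forall i, P i -> (least P <= i)%N.
Proof.
move=> [i Pi]; rewrite /least.
case: xgetP => [m -> //|none]; exfalso.
have exP : exists j, `[< P j >] by exists i; apply/asboolP.
case: (ex_minnP exP) => m /asboolP Pm min_m.
by apply: (none m); split=> // j Pj; apply: min_m; apply/asboolP.
Qed.

(* C_n^r as row vectors over Z/nZ. For n >= 1 the type 'I_n.-1.+1 is 'I_n with
   addition modulo n, including the trivial group for n = 1 (which 'Z_1 is
   not). *)
Definition Cpow (n r : nat) : finZmodType := 'rV['I_n.-1.+1]_r.

Lemma exponent_dvdP (G : finZmodType) (L : nat) :
  (exponent [set: G]%SET %| L)%N <-> forall g : G, g *+ L = 0.
Proof.
split=> [/exponentP eL g|gL]; first by have := eL g (finset.in_setT g).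
by apply/exponentP=> g _; apply: gL.
Qed.

Lemma exponent_Cpow (n r : nat) : (0 < n)%N -> (0 < r)%N ->
  exponent [set: Cpow n r]%SET = n.
Proof.
case: n => // n _; case: r => // r _; apply/eqP; rewrite eqn_dvd.
have valMn (a : 'I_n.+1) k : (a *+ k)%R = (a * k %% n.+1)%N :> nat.
  elim: k => [|k IH]; first by rewrite muln0 mod0n.
  by rewrite mulrS /= IH modnDmr mulnS.
apply/andP; split.
  apply/exponent_dvdP=> v; apply/rowP=> i; rewrite mulmxnE.
  by apply: ord_inj; rewrite valMn modnMl mxE.
have /exponent_dvdP/(_ (const_mx (inord 1))) :=
  dvdnn (exponent [set: Cpow n.+1 r.+1]%SET).
set e := exponent _ => /rowP/(_ ord0); rewrite mulmxnE !mxE.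
move/(congr1 (@nat_of_ord _)); rewrite valMn /=; move: e; case: n {valMn} => [|n] e.
  by rewrite dvd1n.
by rewrite inordK // mul1n => /eqP.
Qed.

(* Sequences over G are lists: the condition is invariant under permutation,
   so the order of the terms is immaterial. *)
Definition zs_bound (L : nat) (G : finZmodType) : set nat :=
  [set t | (0 < t)%N /\ forall S : seq G, (t <= size S)%N ->
     exists T : seq G,
       [/\ subseq T S, size T = L & \sum_(g <- T) g = 0] ].

(* s_L(G), for L a positive multiple of the exponent of G *)
Definition s_ (L : nat) (G : finZmodType) : nat := least (zs_bound L G).

Definition s_exp (G : finZmodType) : nat := s_ (exponent [set: G]%SET) G.

Lemma zs_bound_neq0 (L : nat) (G : finZmodType) :
  (0 < L)%N -> (exponent [set: G]%SET %| L)%N -> zs_bound L G !=set0.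
Proof.
move=> L_gt0 eL; exists (#|G| * L)%N; split.
  by rewrite muln_gt0 L_gt0 andbT; apply/card_gt0P; exists 0.
move=> S leS; have [g leg] : exists g, (L <= count_mem g S)%N.
  apply: contrapT => none.
  have lt g : (count_mem g S <= L.-1)%N.
    by rewrite -ltnS prednK // ltnNge; apply/negP => ?; apply: none; exists g.
  have szS : size S = (\sum_(g : G) count_mem g S)%N.
    elim: S {leS none lt} => [|x S IH] /=; first by rewrite big1.
    by rewrite big_split /= -IH (bigD1 x) //= eqxx big1 // => i; rewrite eq_sym =>
      /negPf ->.
  have : (size S <= #|G| * L.-1)%N.
    by rewrite szS -sum_nat_const; apply: leq_sum => g _; apply: lt.
  move/(leq_trans leS); rewrite leq_mul2l -ltnS prednK // ltnn orbF => /eqP G0.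
  by have := @card0_eq _ _ G0 0; rewrite inE.
exists (nseq L g); split.
- apply: (@subseq_trans _ (nseq (count_mem g S) g)).
    by rewrite -(subnKC leg) nseqD prefix_subseq.
  have -> : nseq (count_mem g S) g = seq.filter (pred1 g) S.
    by rewrite -size_filter; symmetry; apply/all_pred1P; exact: filter_all.
  exact: filter_subseq.
- exact: size_nseq.
- rewrite big_nseq -Monoid.iteropE.
  exact: (exponent_dvdP G L).1 eL g.
Qed.

Definition prime_power (q : nat) : Prop :=
  exists p a, [/\ prime p, (0 < a)%N & q = (p ^ a)%N].

(* M(n), for n >= 2 *)
Definition max_ppow (n : nat) : nat :=
  (\max_(q <- divisors n | `[< prime_power q >]) q)%N.

Lemma max_ppowP n : (2 <= n)%N ->
  [/\ (max_ppow n %| n)%N, prime_power (max_ppow n)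
    & forall q, (q %| n)%N -> prime_power q -> (q <= max_ppow n)%N].
Proof.
move=> n2; have n0 : (0 < n)%N by exact: ltnW.
have ub q : (q %| n)%N -> prime_power q -> (q <= max_ppow n)%N.
  move=> qn ppq; rewrite /max_ppow.
  by apply: (@leq_bigmax_seq _ _ _ id); rewrite -?dvdn_divisors //; apply/asboolP.
have pp : prime_power (pdiv n) by exists (pdiv n), 1%N; rewrite pdiv_prime.
suff [dv ppm] : (max_ppow n %| n)%N /\ prime_power (max_ppow n) by split.
have : max_ppow n = 0%N \/ (max_ppow n %| n)%N /\ prime_power (max_ppow n).
  rewrite /max_ppow big_seq_cond.
  elim/big_ind: _ => [|a b|q /andP[]]; first by left.
    by rewrite /maxn; case: ifP.
  by rewrite -dvdn_divisors // => qn /asboolP; right.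
case=> // M0; have := ub _ (pdiv_dvd n) pp.
by rewrite M0 leqn0 => /eqP p0; have := pdiv_gt0 n; rewrite p0.
Qed.

(* p(n, r), for n >= 2; the prime underlying the prime power M(n) is its
   smallest prime divisor. *)
Definition ppow_ge (n r : nat) : nat :=
  let p := pdiv (max_ppow n) in
  least [set q | (r <= q)%N /\ exists2 t, (0 < t)%N & q = (p ^ t)%N].

Lemma ppow_geP n r : (2 <= n)%N ->
  exists p a t, [/\ prime p, (0 < a)%N, max_ppow n = (p ^ a)%N, (0 < t)%N &
    [/\ ppow_ge n r = (p ^ t)%N, (r <= p ^ t)%N &
        forall u, (0 < u)%N -> (r <= p ^ u)%N -> (p ^ t <= p ^ u)%N]].
Proof.
move=> /max_ppowP[_ [p [a [p_pr a0 Mpa]]] _].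
have pM : pdiv (max_ppow n) = p by rewrite Mpa -(prednK a0) pdiv_pfactor.
rewrite /ppow_ge pM; set P := (X in least X).
have : P !=set0.
  exists (p ^ r.+1)%N; split; last by exists r.+1.
  by apply: ltnW; apply: ltnW; apply: ltn_expl; rewrite prime_gt1.
move=> /leastP[[rq [t t0 qE]] qmin]; exists p, a, t; split=> //.
by rewrite -qE; split=> // u u0 ru; apply: qmin; split=> //; exists u.
Qed.

Section Real.
Variable R : realType.
Implicit Types (c x A : R) (n r k : nat).

Definition log2 x : R := ln x / ln 2.

Definition AD_const c r : R := (c * r%:R * log2 r%:R) ^+ r.

Definition alon_dubiner c : Prop :=
  forall n r, (0 < n)%N -> (2 <= r)%N ->
    (s_exp (Cpow n r))%:R <= AD_const c r * n%:R.

Definition a_ c r : R := AD_const c r - r%:R.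

(* The factor k of n in the index of s: k itself for r in {3, 4} and
   k p(n, r) for r >= 5 (r < 3 is not used). *)
Definition mult k r n : nat := if (r < 5)%N then k else (k * ppow_ge n r)%N.

Definition S_ c k r x A : set nat :=
  [set n | [/\ (2 <= n)%N, n%:R <= x &
     (s_ (mult k r n * n)%N (Cpow n r))%:R
       <= (mult k r n + r)%N%:R * n%:R + a_ c r * (n%:R / ln n%:R `^ A)] ].

Definition Sbar c k r x A : set nat :=
  [set n | [/\ (0 < n)%N, n%:R <= x & ~ S_ c k r x A n] ].

Definition card_Sbar c k r A x : R := (#|` fset_set (Sbar c k r x A)|%fset)%:R.

(* f = O(g) with the implied constant M exposed, so that statements can say
   which parameters it depends on. *)
Definition eventually_le (M : R) (f g : R -> R) : Prop :=
  exists2 x0 : nat, (0 < x0)%N &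
    forall x, x0%:R <= x -> `|f x| <= M * `|g x|.

(* fset_set is the empty set on infinite sets: this does not occur here. *)
Lemma finite_Sbar c k r x A : finite_set (Sbar c k r x A).
Proof.
apply: (@sub_finite_set _ _ `I_(Num.truncn x).+1); last exact: finite_II.
move=> n [_ nx _] /=; rewrite ltnS truncn_ge_nat //.
exact: le_trans nx.
Qed.

End Real.

(* Main.v *)
Require Import Defs.
From mathcomp Require Import all_boot all_order all_algebra all_fingroup.
From mathcomp Require Import abelian.
From mathcomp Require Import all_classical all_reals all_analysis.
From mathcomp Require Import zify ring lra.
Import Order.TTheory GRing.Theory Num.Theory.
Import numFieldNormedType.Exports.
Set Implicit Arguments.
Unset Strict Implicit.
Unset Printing Implicit Defensive.

(* Write n = m q with q = M(n) = p^a. Extracting disjoint zero-sum (modulo m)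
   subsequences of length m and applying the bound s_(Kq)(C_q^r) <= (K + r) q - r
   to their sums gives s_(Kn)(C_n^r) <= (K + r) n + a_r n / q. Hence n is
   exceptional only if all its prime power divisors are below (ln x)^A, and
   Rankin's method bounds the number of such n <= x by x^(1 - 1/A + o(1)).

   The bound for q is a polynomial argument over F_p. A product of binomial
   coefficients is a function of degree r (q - 1) + q' - 1 of the subsequence,
   supported on the zero-sum subsequences of length divisible by q', and a
   function of degree less than the length of a sequence cannot be nonzero at
   its empty subsequence only.
   With q' = p^t q this settles K = p^t >= r and its multiples. With q' = q,
   an additional polynomial factor of degree d in the number of blocks of
   length q allows d lengths to be excluded, and removing blocks one after the
   other settles r = 3, 4 for p >= 5. For p = 2, 3 one passes from K to K + 1
   by splitting off a zero-sum subsequence of length q; these exist by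
   induction on a, starting from the pigeonhole principle (p = 2) or from
   bounds on cap sets in F_3^3 and F_3^4 (p = 3). *)

(** * Degree of functions of sequences *)

Section Degree.
Variables (K : comNzRingType) (T : eqType).
Implicit Types (F G : seq T -> K) (D : nat).
Local Open Scope ring_scope.

(* Degree in the sense of finite differences: prepending a term plays the role
   of the shift. *)
Fixpoint degree_lt D F : Prop :=
  if D is D'.+1 then forall x, degree_lt D' (fun l => F (x :: l) - F l)
  else forall l, F l = 0.

Lemma eq_degree_lt D F G : F =1 G -> degree_lt D F -> degree_lt D G.
Proof.
elim: D F G => [|D IH] F G eFG /= dF; first by move=> l; rewrite -eFG.
by move=> x; apply: IH (dF x) => l; rewrite !eFG.
Qed.

Lemma degree_lt_add D F G :
  degree_lt D F -> degree_lt D G -> degree_lt D (fun l => F l + G l).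
Proof.
elim: D F G => [|D IH] F G /= dF dG; first by move=> l; rewrite dF dG addr0.
move=> x; apply: eq_degree_lt (IH _ _ (dF x) (dG x)) => l.
by rewrite opprD addrACA.
Qed.

Lemma degree_lt0 D : degree_lt D (fun=> 0).
Proof.
elim: D => [|D IH] //= x; apply: eq_degree_lt IH => l.
by rewrite subrr.
Qed.

Lemma degree_lt_const D (a : K) : (0 < D)%N -> degree_lt D (fun=> a).
Proof.
case: D => // D _ /= x; apply: eq_degree_lt (degree_lt0 D) => l.
by rewrite subrr.
Qed.

Lemma degree_lt_sum D (I : Type) (s : seq I) (Fs : I -> seq T -> K) :
  (forall i, degree_lt D (Fs i)) -> degree_lt D (fun l => \sum_(i <- s) Fs i l).
Proof.
move=> dF; elim: s => [|i s IH].
  by apply: eq_degree_lt (degree_lt0 D) => l; rewrite big_nil.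
by apply: eq_degree_lt (degree_lt_add (dF i) IH) => l; rewrite big_cons.
Qed.

Lemma degree_ltW D D' F : (D <= D')%N -> degree_lt D F -> degree_lt D' F.
Proof.
elim: D D' F => [|D IH] D' F.
  by move=> _ F0; apply: eq_degree_lt (degree_lt0 D') => l; rewrite F0.
by case: D' => // D' leDD' dF x; apply: IH (dF x).
Qed.

Lemma degree_lt_cons D F x : degree_lt D F -> degree_lt D (fun l => F (x :: l)).
Proof.
case: D => [|D] /= dF; first by move=> l; apply: dF.
apply: (@eq_degree_lt D.+1 (fun l => F l + (F (x :: l) - F l))) => [l|].
  by rewrite addrC subrK.
by apply: degree_lt_add => //; apply: degree_ltW (dF x).
Qed.

(** A difference of a product is (difference of F) times (shifted G) plus F times (difference of G).
    Each summand loses one degree in one factor, and a shift keeps the degree, so the induction runs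
    on D + E. *)
Lemma degree_lt_mul D E F G :
  degree_lt D.+1 F -> degree_lt E.+1 G -> degree_lt (D + E).+1 (fun l => F l * G l).
Proof.
have [n] := ubnP (D + E); elim: n D E F G => // n IH D E F G ltn dF dG x.
have eqD l : F (x :: l) * G (x :: l) - F l * G l =
    (F (x :: l) - F l) * G (x :: l) + F l * (G (x :: l) - G l).
  by rewrite mulrBl mulrBr addrA subrK.
apply: (eq_degree_lt (fun l => esym (eqD l))); apply: degree_lt_add.
- case: D ltn dF => [|D] ltn dF.
    apply: eq_degree_lt (degree_lt0 _) => l.
    by have /= -> := dF x; rewrite mul0r.
  apply: (IH D E _ _ _ (dF x) (degree_lt_cons x dG)); lia.
- case: E ltn dG => [|E] ltn dG.
    apply: eq_degree_lt (degree_lt0 _) => l.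
    by have /= -> := dG x; rewrite mulr0.
  apply: degree_ltW (IH D E _ _ _ dF (dG x)); lia.
Qed.

Lemma degree_lt_prod (I : Type) (s : seq I) (D : I -> nat) (Fs : I -> seq T -> K) :
  (forall i, degree_lt (D i).+1 (Fs i)) ->
  degree_lt (\sum_(i <- s) D i).+1 (fun l => \prod_(i <- s) Fs i l).
Proof.
move=> dF; elim: s => [|i s IH].
  by apply: eq_degree_lt (@degree_lt_const _ 1 _) => // l; rewrite big_nil.
rewrite big_cons; apply: eq_degree_lt (degree_lt_mul (dF i) IH) => l.
by rewrite big_cons.
Qed.

(** By Vandermonde, prepending x turns 'C(n, d) into the sum of 'C(n, e) 'C(L x, d - e) over e <= d.
    The term e = d cancels in the difference, which leaves lower binomials in n. *)
Lemma degree_lt_binomial (L : T -> nat) (a d : nat) :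
  degree_lt d.+1 (fun l => 'C(\sum_(x <- l) L x + a, d)%:R).
Proof.
have [n] := ubnP d; elim: n d => // n IH d ltdn x.
apply: (@eq_degree_lt d (fun l => \sum_(e <- enum 'I_d)
  'C(\sum_(y <- l) L y + a, e)%:R * 'C(L x, d - e)%:R)).
  move=> l; rewrite big_cons -addnA (addnC (L x)) -binomial.Vandermonde big_ord_recr /= subnn bin0 muln1.
  rewrite natrD addrK natr_sum big_enum /=.
  by apply: eq_bigr => e _; rewrite natrM.
apply: degree_lt_sum => e.
apply: (@degree_ltW (e + 0).+1); first by have := ltn_ord e; lia.
apply: degree_lt_mul; last exact: degree_lt_const.
by apply: IH; have := ltn_ord e; lia.
Qed.

(* The iterated difference of F along s is an alternating sum of the values of F
   at the subsequences of s. *)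
Lemma nonzero_subseq D F (s : seq T) :
  degree_lt D F -> (D <= size s)%N -> F [::] != 0 ->
  exists t, [/\ subseq t s, t != [::] & F t != 0].
Proof.
move=> dF leD F0; apply/not_existsP => none; case/eqP: F0.
have {none} : forall t, subseq t s -> t != [::] -> F t = 0.
  by move=> t ts t0; apply/eqP/negPn/negP => Ft; apply: (none t).
elim: s D F dF leD => [|x s IH] D F dF leD none.
  by case: D dF leD => // /(_ [::]).
case: D dF leD => [/(_ [::]) //|D] dF leD.
have : F [:: x] - F [::] = 0.
  apply: (IH D) (dF x) _ _ => // t ts t0.
  by rewrite !none ?subrr ?(subseq_trans ts) ?subseq_cons //= eqxx.
by rewrite none ?sub0r ?sub1seq ?mem_head // => /eqP; rewrite oppr_eq0 => /eqP.
Qed.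
End Degree.

(** * Zero-sum subsequences of prescribed length *)

Section BinomialModPrime.
Variables (p a : nat).
Hypothesis p_pr : prime p.
Local Notation q := (p ^ a)%N.

Let q_gt0 : (0 < q)%N. Proof. by rewrite expn_gt0 prime_gt0. Qed.

Lemma Fp_natr_eq0 n : (n%:R == 0 :> 'F_p)%R = (p %| n)%N.
Proof. by rewrite -(dvdn_pcharf (pchar_Fp p_pr)). Qed.

Lemma prime_dvd_bin_expn e : (0 < e < q)%N -> (p %| 'C(q, e))%N.
Proof.
move=> /andP[e0 eq]; apply: contraTT eq => ndv; rewrite -leqNgt.
apply: dvdn_leq => //.
have co : coprime q 'C(q, e) by rewrite coprimeXl // prime_coprime.
rewrite -(Gauss_dvdl _ co) -(prednK e0) -mul_bin_diag.
exact: dvdn_mulr.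
Qed.

Lemma natr_binDq n d : (d < q)%N -> ('C(n + q, d)%:R = 'C(n, d)%:R :> 'F_p)%R.
Proof.
move=> dq; rewrite -binomial.Vandermonde big_ord_recr /= subnn bin0 muln1.
rewrite natrD -[RHS]add0r; congr (_ + _)%R; apply/eqP; rewrite Fp_natr_eq0.
apply: dvdn_sum => e _; apply/dvdn_mull/prime_dvd_bin_expn.
by have := ltn_ord e; lia.
Qed.

(** Modulo p the binomial 'C(-, q - 1) has period q, so only the residue i of n matters: i = 0 gives
    'C(q - 1, q - 1) = 1, and i > 0 gives 'C(i - 1, q - 1) = 0. *)
Lemma natr_bin_indicator n :
  ('C(n + q.-1, q.-1)%:R = (q %| n)%N%:R :> 'F_p)%R.
Proof.
have per m i : ('C(m * q + i, q.-1)%:R = 'C(i, q.-1)%:R :> 'F_p)%R.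
  elim: m => [|m IH]; first by rewrite mul0n.
  by rewrite mulSn -addnA addnC natr_binDq // prednK.
rewrite {1}(divn_eq n q) -addnA per /dvdn.
have := ltn_pmod n q_gt0; case: (n %% q)%N => [|i] iq; first by rewrite add0n binn.
by rewrite addSnnS prednK // natr_binDq ?prednK // bin_small //; lia.
Qed.

(** A case of Lucas' theorem. It makes the number of blocks of length q a function of degree q of
    the sequence. *)
Lemma natr_bin_mulq j : ('C(j * q, q)%:R = j%:R :> 'F_p)%R.
Proof.
elim: j => [|j IH]; first by rewrite mul0n bin_small.
rewrite mulSn addnC -binomial.Vandermonde big_ord_recr /= subnn bin0 muln1.
rewrite (bigD1 (Ordinal q_gt0)) //= bin0 subn0 binn !natrD IH -[j.+1]add1n natrD.
congr (_ + _)%R; rewrite -[RHS]addr0; congr (_ + _)%R; apply/eqP.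
rewrite Fp_natr_eq0; apply: dvdn_sum => e e0.
apply/dvdn_mull/prime_dvd_bin_expn; have := ltn_ord e.
by move: e0; rewrite -val_eqE /=; lia.
Qed.

End BinomialModPrime.

Section ZeroSums.
Variables (r : nat) (V : eqType) (v : 'I_r -> V -> nat).

(** A term x stands for the vector of its coordinates [v j x]. These are natural numbers rather than
    residues, so that their sums can enter binomial coefficients and be divided by m. *)
Definition zero_sum n (t : seq V) := forall j, (n %| \sum_(x <- t) v j x)%N.

Definition has_zero_sum n L (s : seq V) :=
  exists t, [/\ subseq t s, size t = L & zero_sum n t].

(** The three factors have degrees r (p^a - 1), p^b - 1 and |B| p^b. At the empty sequence the
    factor for c in B is -c, which is nonzero modulo p. [sharp_pow] uses b = a + t with B empty,
    [block_pick] uses b = a. *)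
Lemma zero_sum_avoiding p a b (B : seq nat) (s : seq V) : prime p ->
  all (fun c => ~~ (p %| c)%N) B ->
  (r * (p ^ a).-1 + size B * p ^ b + p ^ b <= size s)%N ->
  exists c, [/\ (0 < c)%N, (c * p ^ b <= size s)%N, c \notin B &
    has_zero_sum (p ^ a) (c * p ^ b) s].
Proof.
move=> p_pr Bp les.
have q_gt0 d : (0 < p ^ d)%N by rewrite expn_gt0 prime_gt0.
(* F1 detects zero sums, F2 lengths divisible by p^b, and F3 excludes the
   lengths c p^b with c in B. *)
pose F1 (l : seq V) : 'F_p :=
  (\prod_(j <- enum 'I_r) 'C(\sum_(x <- l) v j x + (p ^ a).-1, (p ^ a).-1)%:R)%R.
pose F2 (l : seq V) : 'F_p := 'C(\sum_(x <- l) 1 + (p ^ b).-1, (p ^ b).-1)%:R%R.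
pose F3 (l : seq V) : 'F_p :=
  (\prod_(c <- B) ('C(\sum_(x <- l) 1 + 0, p ^ b)%:R + - c%:R))%R.
have F1E l : reflect (zero_sum (p ^ a) l) (F1 l != 0%R).
  rewrite /F1 prodf_seq_neq0; apply: (iffP allP) => [h j|h j _ /=].
    have := h j (mem_enum _ _); rewrite natr_bin_indicator //=.
    by case: (_ %| _)%N; rewrite // eqxx.
  by rewrite natr_bin_indicator // h oner_neq0.
have F2E l : (F2 l != 0%R) = (p ^ b %| size l)%N.
  by rewrite /F2 sum1_size natr_bin_indicator //; case: (_ %| _)%N; rewrite ?oner_neq0 ?eqxx.
have F3E l c : (size l = c * p ^ b)%N -> F3 l != 0%R -> c \notin B.
  rewrite /F3 prodf_seq_neq0 => sl /allP h; apply/negP => /h /=.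
  by rewrite addn0 sum1_size sl natr_bin_mulq // subrr eqxx.
have dF1 : degree_lt (r * (p ^ a).-1).+1 F1.
  have := @degree_lt_prod _ _ _ (enum 'I_r) (fun=> (p ^ a).-1) _
    (fun i => @degree_lt_binomial _ _ (v i) (p ^ a).-1 (p ^ a).-1).
  by rewrite big_enum sum_nat_const card_ord; apply.
have dF3 : degree_lt (size B * p ^ b).+1 F3.
  have := @degree_lt_prod 'F_p V _ B (fun=> p ^ b)%N
    (fun c l => ('C(\sum_(x <- l) 1 + 0, p ^ b)%:R + - c%:R)%R).
  rewrite big_const_seq count_predT iter_addn_0 mulnC; apply => c.
  by apply: degree_lt_add; [exact: degree_lt_binomial|exact: degree_lt_const].
have dF := degree_lt_mul (degree_lt_mul dF1
  (@degree_lt_binomial 'F_p V (fun=> 1%N) (p ^ b).-1 (p ^ b).-1)) dF3.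
have [|//|t [ts t0 Ft]] := nonzero_subseq dF (s := s).
- by have := q_gt0 b; lia.
- rewrite !mulf_neq0 //.
  + by apply/F1E => j; rewrite big_nil dvdn0.
  + by rewrite -/(F2 [::]) F2E dvdn0.
  rewrite prodf_seq_neq0; apply: sub_all Bp => c /=.
  by rewrite big_nil bin_small // sub0r oppr_eq0 Fp_natr_eq0.
move: Ft; rewrite !mulf_eq0 !negb_or => /andP[/andP[Ft1 Ft2] Ft3].
have /dvdnP[c tc] : (p ^ b %| size t)%N by rewrite -F2E.
exists c; split.
- by case: c tc => //; move: t0; rewrite -size_eq0; case: (size t).
- by rewrite -tc size_subseq.
- exact: F3E tc Ft3.
- by exists t; split=> //; apply/F1E.
Qed.

End ZeroSums.

(** * Blocks over p-groups *)

Lemma subseq_perm_cat (T : eqType) (t s : seq T) :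
  subseq t s -> exists u, perm_eq s (t ++ u).
Proof.
elim: s t => [|x s IH] t; first by move=> /eqP ->; exists [::].
case: t => [|y t]; first by exists (x :: s).
rewrite /=; case: eqP => [->|_] /IH[u su]; first by exists u; rewrite perm_cons.
exists (x :: u); rewrite perm_sym (perm_catCA (y :: t) [:: x] u) /= perm_cons.
by rewrite perm_sym.
Qed.

Section Removal.
Variables (r : nat) (V : eqType) (v : 'I_r -> V -> nat).

Lemma has_zero_sum_perm n s t u :
  perm_eq s (t ++ u) -> zero_sum v n t -> has_zero_sum v n (size t) s.
Proof.
move=> /seq.permP stu zt.
have /count_subseqP[t' t's tt'] : forall x, count_mem x t <= count_mem x s.
  by move=> x; rewrite stu count_cat leq_addr.
exists t'; split=> //; first by rewrite (perm_size tt').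
by move=> j; rewrite -(perm_big _ tt'); apply: zt.
Qed.

Lemma zero_sum_cat n s t : zero_sum v n s -> zero_sum v n t -> zero_sum v n (s ++ t).
Proof. by move=> zs zt j; rewrite big_cat dvdn_add. Qed.

Lemma has_zero_sum_subseq n L s t :
  subseq s t -> has_zero_sum v n L s -> has_zero_sum v n L t.
Proof. by move=> st [w [ws wL zw]]; exists w; split=> //; apply: subseq_trans st. Qed.

Lemma has_zero_sum_remove n L s : has_zero_sum v n L s ->
  exists u, size s = L + size u /\
    forall M, has_zero_sum v n M u ->
      has_zero_sum v n M s /\ has_zero_sum v n (M + L) s.
Proof.
move=> [t [/subseq_perm_cat[u stu] <- zt]]; exists u.
split=> [|_ [w [/subseq_perm_cat[u' uwu] <- zw]]].
  by rewrite (perm_size stu) size_cat.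
have stwu : perm_eq s (t ++ w ++ u').
  by rewrite (perm_trans stu) // perm_cat2l.
split; first by apply: has_zero_sum_perm zw; rewrite (perm_trans stwu) // perm_catCA.
rewrite addnC -size_cat; apply: has_zero_sum_perm (zero_sum_cat zt zw).
by rewrite -catA; exact: stwu.
Qed.

End Removal.

Section PrimePower.
Variables (p a r : nat) (V : eqType) (v : 'I_r -> V -> nat).
Hypotheses (p_pr : prime p) (r_gt0 : 0 < r).
Local Notation q := (p ^ a).
Implicit Types (s u : seq V) (k j m : nat).

Definition block k s := has_zero_sum v q (k * q) s.

(* The case L = k q of the conjectural value s_(kq)(C_q^r) = (k + r) q - r. *)
Definition sharp k := forall s, (k + r) * q <= size s + r -> block k s.

Let q_gt0 : 0 < q. Proof. by rewrite expn_gt0 prime_gt0. Qed.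

Lemma block_remove j s : block j s ->
  exists u, size s = j * q + size u /\
    forall i, block i u -> block i s /\ block (i + j) s.
Proof.
move=> /has_zero_sum_remove[u [su bu]]; exists u; split=> // i /bu.
by rewrite /block mulnDl.
Qed.

Lemma sharpD j k : sharp j -> sharp k -> sharp (j + k).
Proof.
move=> sj sk s les; have /block_remove[u [su bu]] : block j s.
  by apply: sj; apply: leq_trans les; rewrite leq_mul2r; lia.
have /bu[_] : block k u by apply: sk; move: les; rewrite su; lia.
by rewrite addnC.
Qed.

Lemma sharpM i k : 0 < i -> sharp k -> sharp (i * k).
Proof.
move=> i_gt0 sk; elim: i i_gt0 => // [[|i]] IH _; first by rewrite mul1n.
by rewrite mulSn; apply: sharpD => //; apply: IH.
Qed.

(** With P = p^t, lengths are made divisible by P q. The sequence is cut to P q + r (q - 1) terms,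
    fewer than 2 P q because r <= P, so the length found is P q itself. *)
Lemma sharp_pow t : r <= p ^ t -> sharp (p ^ t).
Proof.
move=> rt s les; set P := p ^ t in rt les *.
have Pq : p ^ (a + t) = P * q by rewrite expnD mulnC.
set s' := take (P * q + r * q.-1) s.
have rq : r * q = r * q.-1 + r by rewrite -{1}(prednK q_gt0) mulnS addnC.
have sz' : size s' = P * q + r * q.-1.
  by rewrite size_take_min; apply/minn_idPl; move: les; rewrite mulnDl; lia.
have rPq : r * q.-1 < P * q.
  apply: leq_trans (_ : r * q <= _); first by rewrite rq; lia.
  by rewrite leq_mul2r rt orbT.
have [||c []] := @zero_sum_avoiding r V v p a (a + t) [::] s' p_pr => //.
  by rewrite sz' Pq /=; lia.
rewrite sz' Pq => c0 lec _ hc.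
have c1 : c = 1.
  have : c * (P * q) < 2 * (P * q) by lia.
  by rewrite ltn_mul2r; lia.
rewrite /block -[P * q]mul1n -c1.
exact: has_zero_sum_subseq (take_subseq _ _) hc.
Qed.

(* Interpolation: a polynomial in the number of blocks, of degree at most
   m - r, vanishes at the lengths in [1, m] outside js but not at 0. *)
Lemma block_pick m js s : r <= m < p -> uniq js -> r <= size js ->
  all (fun j => 0 < j <= m) js -> m.+1 * q <= size s + r ->
  exists2 j, j \in js & block j s.
Proof.
move=> /andP[rm mp] ujs rjs mjs les.
pose B := [seq c <- iota 1 m | c \notin js].
have sB : size B <= m - r.
  suff : size js + size B <= m by lia.
  rewrite size_filter -[leqRHS](size_iota 1) -(count_predC (mem js) (iota 1 m)).
  have -> : count (mem js) (iota 1 m) = size js.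
    rewrite -size_filter; apply/perm_size/uniq_perm => //.
      exact/filter_uniq/iota_uniq.
    move=> j; rewrite mem_filter mem_iota /=; case: (boolP (j \in js)) => //= jj.
    by have := allP mjs _ jj; lia.
  by rewrite leq_add2l; apply: sub_count.
(* This is exactly r (q - 1) + (m - r) q + q, the length required for m - r excluded values, and it
   is below (m + 1) q, which forces c <= m. *)
set s' := take (m.+1 * q - r) s.
have sz' : size s' = m.+1 * q - r.
  by rewrite size_take_min; apply/minn_idPl; lia.
have rmq : r * q <= m * q by rewrite leq_mul2r rm orbT.
have [||c [c0 lec cB hc]] := @zero_sum_avoiding r V v p a a B s' p_pr => //.
- apply/allP => c; rewrite mem_filter mem_iota => /andP[_ /andP[c0 cm]].
  by rewrite gtnNdvd //; lia.
- rewrite sz'; apply: (@leq_trans (r * q.-1 + (m - r) * q + q)).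
    by rewrite leq_add2r leq_add2l leq_mul2r sB orbT.
  have : r * q = r * q.-1 + r by rewrite -{1}(prednK q_gt0) mulnS addnC.
  by rewrite mulnBl; lia.
exists c; last exact: has_zero_sum_subseq (take_subseq _ _) hc.
have : c <= m.
  have : c * q < m.+1 * q by rewrite sz' in lec; lia.
  by rewrite ltn_mul2r; lia.
by move=> cm; apply: contraR cB => cj; rewrite mem_filter mem_iota cj; lia.
Qed.

End PrimePower.

(** * Rank three and four, p >= 5 *)

Section Rank3.
Variables (p a : nat) (V : eqType) (v : 'I_3 -> V -> nat).
Hypothesis p_pr : prime p.
Local Notation block := (block p a v).
Local Notation sharp := (sharp p a v).

Lemma block_pick3 m i j k s : 3 <= m < p ->
  [&& 0 < i <= m, 0 < j <= m, 0 < k <= m, i != j, i != k & j != k] ->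
  m.+1 * p ^ a <= size s + 3 -> [\/ block i s, block j s | block k s].
Proof.
move=> mp /and5P[i1 j1 k1 ij /andP[ik jk]] les.
have [||l] := block_pick v p_pr isT mp (js := [:: i; j; k]) _ isT _ les.
- by rewrite /= !inE negb_or ij ik jk.
- by rewrite /= i1 j1 k1.
by rewrite !inE => /or3P[] /eqP ->; [constructor 1|constructor 2|constructor 3].
Qed.

(** Picking with m = k takes (k + 1) q - 3 of the (k + 3) q - 3 terms, so blocks of total length 2 q
    may be removed first. Each picked length completes the removed blocks to k or contradicts an
    earlier exclusion: first block 1 is excluded, then block 2 is forced and completed by k - 2. *)
Lemma sharp3_ltp k : 4 <= k < p -> sharp k.
Proof.
case: k => [|[|[|[|k]]]] //= kp s les; apply: contrapT => no_k.
have no_1 : ~ block 1 s.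
  move=> /block_remove[u [su bu]]; have no_1 : ~ block 1 u.
    move=> /block_remove[w [sw bw]].
    have [|||/bw[_ /bu[]]|/bw[/bu[]]|/bw[/bu[]]] //= :=
      @block_pick3 k.+4 k.+2 k.+3 k.+4 w; rewrite ?addn1 //; lia.
  by have [|||/no_1|/bu[_]|/bu[]] //= := @block_pick3 k.+4 1 k.+3 k.+4 u;
    rewrite ?addn1 //; lia.
have [|||/no_1|/block_remove[u [su bu]]|] //= := @block_pick3 k.+4 1 2 k.+4 s; try lia.
by have [|||/bu[]|/bu[_]|/bu[]] //= := @block_pick3 k.+4 1 k.+2 k.+4 u;
  rewrite ?addn2 //; lia.
Qed.

(** Picked lengths are at most 4 here. Since 5 is sharp, block k - 5 is excluded at once; then the
    other one of 1 and 2 is excluded, and the end is 3 + 3 = 6 or 4 + 3 = 7. *)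
Lemma sharp3_5 k : p = 5 -> k \in [:: 6; 7] -> sharp k.
Proof.
move=> p5; have sharp5 : sharp 5 by rewrite -p5 -(expn1 p); apply: sharp_pow; rewrite ?p5.
have pick := block_pick3 (m := 4); rewrite {1}p5 in pick.
rewrite !inE => /orP[] /eqP -> s les; apply: contrapT => no_k.
- have no_1 : ~ block 1 s.
    by move=> /block_remove[u [su bu]]; have /bu[] : block 5 u by apply: sharp5; lia.
  have no_2 : ~ block 2 s.
    move=> /block_remove[u [su bu]].
    have [|||/bu[]|/block_remove[w [sw bw]]|/bu[]] //= := pick 1 2 4 u; try lia.
    by have [|||/bw[/bu[]]|/bw[_ /bu[]]|/bw[/bu[]]] //= := pick 1 2 4 w; lia.
  have [|||//|//|/block_remove[u [su bu]]] //= := pick 1 2 3 s; try lia.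
  by have [|||/bu[]|/bu[]|/bu[]] //= := pick 1 2 3 u; lia.
- have no_2 : ~ block 2 s.
    by move=> /block_remove[u [su bu]]; have /bu[] : block 5 u by apply: sharp5; lia.
  have no_1 : ~ block 1 s.
    move=> /block_remove[u [su bu]].
    have [|||/bu[]|/bu[]|/block_remove[w [sw bw]]] //= := pick 1 2 3 u; try lia.
    by have [|||/bw[/bu[]]|/bw[/bu[]]|/bw[_ /bu[]]] //= := pick 1 2 3 w; lia.
  have [|||//|//|/block_remove[u [su bu]]] //= := pick 1 2 4 s; try lia.
  by have [|||/bu[]|/bu[]|/bu[]] //= := pick 1 2 3 u; lia.
Qed.

(** Both 4 and 5 are sharp for every p >= 5, and 6 and 7 are settled separately for p = 5. Adding 4
    repeatedly to 4, 5, 6 and 7 then reaches every k >= 6. *)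
Lemma sharp3_ge5 k : 5 <= p -> 6 <= k -> sharp k.
Proof.
move=> p5 k6; have sharp_p : sharp p.
  by rewrite -(expn1 p); apply: sharp_pow; rewrite ?expn1 //; lia.
have base i : 4 <= i <= 7 -> i <= p -> sharp i.
  move=> i4; rewrite leq_eqVlt => /orP[/eqP-> //|ip].
  by apply: sharp3_ltp; lia.
have base67 i : 6 <= i <= 7 -> sharp i.
  move=> i6; have [p7|p7] := leqP 7 p; first by apply: base; lia.
  apply: sharp3_5; last by rewrite !inE; lia.
  by move: p_pr p5 p7; case: p => [|[|[|[|[|[|[|]]]]]]].
have [n] := ubnP k; elim: n k k6 => // n IH k k6 kn.
have [k7|k7] := leqP k 7; first by apply: base67; lia.
have [k9|k9] := leqP k 9.
  have -> : k = 4 + (k - 4) by lia.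
  by apply: sharpD => //; apply: base; lia.
have -> : k = 4 + (k - 4) by lia.
by apply: sharpD => //; [apply: base; lia|apply: IH; lia].
Qed.

End Rank3.

Definition subset_sums3 b c d := [:: 0; b; c; c + b; d; d + b; d + c; d + c + b].

(* 12 p is a multiple of p that keeps the truncated subtraction exact, as the
   sums are at most 12. *)
Definition residues p k b c d :=
  undup [seq (k + 12 * p - t) %% p | t <- subset_sums3 b c d].

Section Rank4.
Variables (p a : nat) (V : eqType) (v : 'I_4 -> V -> nat).
Hypothesis p_pr : prime p.
Local Notation block := (block p a v).
Local Notation sharp := (sharp p a v).

Lemma block_pick4 m h i j k s : 4 <= m < p ->
  uniq [:: h; i; j; k] && all (fun l => 0 < l <= m) [:: h; i; j; k] ->
  m.+1 * p ^ a <= size s + 4 ->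
  [\/ block h s, block i s, block j s | block k s].
Proof.
move=> mp /andP[hU hA] les.
have [l] := block_pick v p_pr isT mp hU isT hA les.
by rewrite !inE => /or4P[] /eqP ->;
  [constructor 1|constructor 2|constructor 3|constructor 4].
Qed.

(** The scheme of [sharp3_ltp] with room for removing 3 q terms: blocks 1 and 2 are excluded in
    turn, then block 3 is forced and completed by k - 3. The smallest complement, k - 5 after
    removing 2 and 3, differs from 1 because k >= 7. *)
Lemma sharp4_ltp k : 7 <= k < p -> sharp k.
Proof.
case: k => [|[|[|[|[|[|[|k]]]]]]] //= kp s les; apply: contrapT => no_k.
have pick m h i j l u : m < k.+4.+4 -> 4 <= m ->
  uniq [:: h; i; j; l] && all (fun l => 0 < l <= m) [:: h; i; j; l] ->
  m.+1 * p ^ a <= size u + 4 -> [\/ block h u, block i u, block j u | block l u].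
  by move=> mk m4; apply: block_pick4; lia.
have no_1 : ~ block 1 s.
  move=> /block_remove[u [su bu]]; have no_1 : ~ block 1 u.
    move=> /block_remove[w [sw bw]]; have no_1 : ~ block 1 w.
      move=> /block_remove[x [sx bx]].
      have [||||/bx[_ /bw[_ /bu[_]]]|/bx[/bw[_ /bu[_]]]|/bx[/bw[/bu[_]]]|/bx[/bw[/bu[]]]] //= :=
        @pick (7 + k) (4 + k) (5 + k) (6 + k) (7 + k) x; rewrite ?addn1 //= ?inE; lia.
    have [||||/no_1|/bw[_ /bu[_]]|/bw[/bu[_]]|/bw[/bu[]]] //= :=
      @pick (7 + k) 1 (5 + k) (6 + k) (7 + k) w; rewrite ?addn1 //= ?inE; lia.
  have [||||/no_1|/block_remove[w [sw bw]]|/bu[_]|/bu[]] //= :=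
    @pick (7 + k) 1 2 (6 + k) (7 + k) u; rewrite ?addn1 //= ?inE; try lia.
  have [||||/bw[]|/bw[_ /bu[_]]|/bw[_ /bu[]]|/bw[/bu[_]]] //= :=
    @pick (7 + k) 1 (4 + k) (5 + k) (6 + k) w; rewrite ?addn1 ?addn2 //= ?inE; lia.
have no_2 : ~ block 2 s.
  move=> /block_remove[u [su bu]].
  have [||||/bu[]|/block_remove[w [sw bw]]|/bu[_]|/bu[]] //= :=
    @pick (7 + k) 1 3 (5 + k) (7 + k) u; rewrite ?addn2 //= ?inE; try lia.
  have [||||/bw[/bu[]]|/bw[_ /bu[_]]|/bw[_ /bu[]]|/bw[/bu[_]]] //= :=
    @pick (5 + k) 1 (2 + k) (4 + k) (5 + k) w; rewrite ?addn2 ?addn3 //= ?inE; lia.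
have [||||//|//|/block_remove[u [su bu]]|//] //= :=
  @pick (7 + k) 1 2 3 (7 + k) s; rewrite //= ?inE; try lia.
have [||||/bu[]|/bu[]|/bu[_]|/bu[]] //= :=
  @pick (7 + k) 1 2 (4 + k) (7 + k) u; rewrite ?addn3 //= ?inE; lia.
Qed.

(* By Cauchy-Davenport, three nonzero residues have at least four subset sums
   modulo p; hence, after removal of three blocks of length j q with j <= 4,
   four lengths are excluded for the remaining blocks. *)
Lemma sharp4_mod k : 4 < p -> p <= 7 -> 18 <= k ->
  all (fun b => all (fun c => all (fun d =>
    all (fun i => 4 <= size (residues p i b c d)) (iota 0 p))
    (iota 1 4)) (iota 1 4)) (iota 1 4) -> sharp k.
Proof.
move=> p4 p7 k18 chk s les.
have sharp_p i : 0 < i -> sharp (i * p).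
  by move=> i0; apply: sharpM => //; rewrite -(expn1 p); apply: sharp_pow; rewrite ?expn1; lia.
have step u : 5 * p ^ a <= size u + 4 -> exists b w, [/\ b \in iota 1 4,
    size u = b * p ^ a + size w &
    forall i, block i w -> block i u /\ block (i + b) u].
  move=> leu; have [|| |B|B|B|B] := @block_pick4 4 1 2 3 4 u; rewrite ?p4 //;
    by case: (block_remove B) => w [sw bw]; eexists; exists w; split; [|exact: sw|exact: bw].
have lek : 18 * p ^ a <= k * p ^ a by rewrite leq_mul2r k18 orbT.
have [|b [u [b4 su bu]]] := step s; first by lia.
have le4 i : i \in iota 1 4 -> i * p ^ a <= 4 * p ^ a.
  by rewrite mem_iota leq_mul2r => /andP[_ i5]; apply/orP; right.
have leb := le4 _ b4.
have [|c [w [c4 sw bw]]] := step u; first by lia.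
have lec := le4 _ c4.
have [|d [x [d4 sx bx]]] := step w; first by lia.
have led := le4 _ d4.
have k_mod : k %% p \in iota 0 p by rewrite mem_iota ltn_pmod ?prime_gt0.
have := allP (allP (allP (allP chk b b4) c c4) d d4) _ k_mod.
set js := residues _ _ _ _ _ => sz_js.
have b_sum t i : t \in subset_sums3 b c d -> block i x -> block (i + t) s.
  move=> + /bx[x1 x2].
  have b_w j : block j w -> [/\ block j s, block (j + b) s, block (j + c) s &
      block (j + c + b) s].
    by move=> /bw[/bu[? ?] /bu[? ?]].
  have [x3 x4 x5 x6] := b_w _ x1; have [x7 x8 x9 x10] := b_w _ x2.
  rewrite !inE => /or4P[/eqP->|/eqP->|/eqP->|].
  - by rewrite addn0.
  - by [].
  - by [].
  by move=> /or4P[/eqP->|/eqP->|/eqP->|/orP[]/eqP->]; rewrite ?addnA.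
suff [j j_js bj] : exists2 j, j \in js & block j x.
  move: j_js; rewrite mem_undup => /mapP[t tS jE].
  have le12 : t <= 12.
    by move: tS b4 c4 d4; rewrite !mem_iota !inE; lia.
  have jp : j < p by rewrite jE ltn_pmod ?prime_gt0.
  have jtk : j + t = k %[mod p].
    rewrite jE modnDml subnK; last by nia.
    by rewrite addnC modnMDl modn_mod.
  have [y [sy b_y]] := block_remove (b_sum _ _ tS bj).
  (* Here j <= p - 1 <= 6 and t <= 12, so j + t <= 18 <= k. The missing multiple of p is supplied by
     [sharp_p]. *)
  have /dvdnP[i ik] : p %| k - (j + t) by rewrite -eqn_mod_dvd ?jtk //; lia.
  have kE : k = i * p + (j + t) by lia.
  have [i0|i0] := posnP i; first by rewrite kE i0; apply: b_sum tS bj.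
  rewrite kE; apply: (b_y _ _).2; apply: sharp_p => //.
  by move: les; rewrite sy {1}kE; lia.
have [j0|j0] := boolP (0 \in js).
  by exists 0 => //; exists [::]; split=> [||?]; rewrite ?sub0seq ?mul0n ?big_nil.
apply: (@block_pick p a 4 V v p_pr isT p.-1) => //; first by lia.
- exact: undup_uniq.
- apply/allP => j j_js; have j_gt0 : 0 < j by rewrite lt0n; apply: contraNneq j0 => <-.
  rewrite j_gt0 -ltnS prednK ?prime_gt0 //.
  by move: j_js; rewrite mem_undup => /mapP[t _ ->]; rewrite ltn_pmod ?prime_gt0.
(* At most 12 q terms were removed from at least 22 q - 4, so x keeps 10 q - 4, more than the p q -
   4 needed for m = p - 1. *)
- have : p * p ^ a <= 7 * p ^ a by rewrite leq_mul2r p7 orbT.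
  by rewrite prednK ?prime_gt0 //; lia.
Qed.

(** The cases p = 5, 7 are a finite check of residues. For p >= 11 all of 7, ..., 11 are sharp; sums
    of two of them cover 14, ..., 22, and steps of 7 do the rest. *)
Lemma sharp4_ge5 k : 5 <= p -> 18 <= k -> sharp k.
Proof.
move=> p5 k18; have sharp_p : sharp p.
  by rewrite -(expn1 p); apply: sharp_pow; rewrite ?expn1 //; lia.
have [p11|p11] := ltnP p 11.
  have p57 : (p == 5) || (p == 7).
    move: p_pr p5 p11; case: p => [|[|[|[|[|[|[|[|[|[|[|]]]]]]]]]]] //.
  apply: sharp4_mod => //; first by case/orP: p57 => /eqP ->.
  by case/orP: p57 => /eqP ->; vm_compute.
have base i : 7 <= i <= 11 -> sharp i.
  move=> i7; have [ip|ip] := ltnP i p; first by apply: sharp4_ltp; lia.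
  by have -> : i = p by lia.
have {k18} : 14 <= k by apply: leq_trans k18.
have [n] := ubnP k; elim: n k => // n IH k kn k14.
have [k18|k18] := leqP k 18.
  have -> : k = 7 + (k - 7) by lia.
  by apply: sharpD => //; apply: base; lia.
have [k22|k22] := leqP k 22.
  have -> : k = 11 + (k - 11) by lia.
  by apply: sharpD => //; apply: base; lia.
have -> : k = 7 + (k - 7) by lia.
by apply: sharpD => //; [apply: base; lia|apply: IH; lia].
Qed.

End Rank4.

(** * Multiplicativity *)

(* The terms range over an arbitrary type V so that zero_sum_boundM can take
   sequences as terms. *)
Definition zero_sum_bound r n L t := forall (V : eqType) (v : 'I_r -> V -> nat) s,
  t <= size s -> has_zero_sum v n L s.

Lemma subseq_map_lift (T U : eqType) (f : T -> U) (t : seq U) (s : seq T) :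
  subseq t (map f s) -> exists2 s', subseq s' s & t = map f s'.
Proof.
move=> /subseqP[m sm ->]; exists (mask m s); last by rewrite map_mask.
by apply/subseqP; exists m; rewrite // -(size_map f).
Qed.

Section Products.
Variables (r m : nat).
Hypothesis m_gt0 : 0 < m.

Lemma disjoint_zero_sums (V : eqType) (v : 'I_r -> V -> nat) L t i s :
  zero_sum_bound r m L t -> i * L + t <= size s + L ->
  exists ts u, [/\ size ts = i, all (fun w => size w == L) ts,
    (forall w, w \in ts -> zero_sum v m w) & perm_eq s (flatten ts ++ u)].
Proof.
move=> bt; elim: i => [|i IH] les; first by exists [::], s.
have [|ts [u [iE sz_ts zs_ts sE]]] := IH; first by lia.
have sz_flat : size (flatten ts) = size ts * L.
  elim: ts sz_ts {zs_ts sE iE} => //= w ts IHts /andP[/eqP wL /IHts].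
  by rewrite size_cat wL mulSn => ->.
have [|w [/subseq_perm_cat[u' uE] wL zw]] := bt V v u.
  by move: les; rewrite (perm_size sE) size_cat sz_flat iE; lia.
exists (w :: ts), u'; split=> //=; rewrite ?iE ?wL ?eqxx //.
  by move=> x; rewrite inE => /predU1P[->|/zs_ts].
by rewrite (perm_trans sE) // -catA perm_sym perm_catCA perm_cat2l perm_sym.
Qed.

(** Greedy extraction yields t2 disjoint subsequences of length m with sums divisible by m. These
    sums divided by m form a sequence modulo q, to which the second bound applies. *)
Lemma zero_sum_boundM q L t1 t2 : 0 < t2 ->
  zero_sum_bound r m m t1 -> zero_sum_bound r q L t2 ->
  zero_sum_bound r (m * q) (L * m) (m * t2.-1 + t1).
Proof.
move=> t2_gt0 b1 b2 V v s les.
have [|ts [u [sz_ts szs zs sE]]] := @disjoint_zero_sums V v m t1 t2 s b1.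
  by rewrite -{1}(prednK t2_gt0) mulSn -addnA addnC leq_add2r mulnC.
pose v' j (w : seq V) := (\sum_(x <- w) v j x) %/ m.
have [|ts' [ts'ts <- zts']] := b2 (seq V) v' ts; first by rewrite sz_ts.
have mem_ts := mem_subseq ts'ts.
have zs' : zero_sum v (m * q) (flatten ts').
  move=> j; rewrite big_flatten (eq_big_seq (fun w => m * v' j w)).
    by rewrite -big_distrr /= dvdn_pmul2l // zts'.
  by move=> w /mem_ts /zs wz; rewrite /= mulnC divnK.
have -> : size ts' * m = size (flatten ts').
  elim: ts' {zs' zts' ts'ts} mem_ts => //= w ts' IH mem_ts.
  rewrite size_cat mulSn IH => [|x xts']; last by apply: mem_ts; rewrite inE xts' orbT.
  by rewrite (eqP (allP szs w _)) // mem_ts // mem_head.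
have [w tsE] := subseq_perm_cat ts'ts.
apply: (has_zero_sum_perm (u := flatten w ++ u)) zs'.
by rewrite (perm_trans sE) // catA perm_cat2r -flatten_cat perm_flatten.
Qed.

End Products.

(** Bounds of the form b (n - 1) + 1 are reproduced by [zero_sum_boundM]: p b (p^a - 1) + b (p - 1)
    + 1 = b (p^(a+1) - 1) + 1. *)
Lemma zero_sum_bound_expn r p a b : 0 < p ->
  zero_sum_bound r p p (b * p.-1).+1 ->
  zero_sum_bound r (p ^ a) (p ^ a) (b * (p ^ a).-1).+1.
Proof.
move=> p_gt0 bp; elim: a => [|a IH] V v s les.
  case: s les => // x s _; exists [:: x]; rewrite /= eqxx; split=> //.
  exact: sub0seq.
rewrite expnS {2}mulnC; apply: (zero_sum_boundM p_gt0 _ bp IH) => //.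
apply: leq_trans les; rewrite /= addnS ltnS expnS.
have : 0 < p ^ a by rewrite expn_gt0 p_gt0.
case: (p ^ a) => // n _; case: p p_gt0 {bp IH} => // p _; lia.
Qed.

(** A block of length q splits off, since b (q - 1) + 1 <= b q - r <= (k + 1 + r) q - r, and the
    remainder is long enough for k. *)
Lemma sharp_succ p a r (V : eqType) (v : 'I_r -> V -> nat) b k :
  prime p -> 0 < r -> zero_sum_bound r p p (b * p.-1).+1 ->
  b <= k.+1 + r -> r < b -> sharp p a v k -> sharp p a v k.+1.
Proof.
move=> p_pr r_gt0 bp bk rb sk s les.
have q_gt0 : 0 < p ^ a by rewrite expn_gt0 prime_gt0.
have /block_remove[u [su bu]] : block p a v 1 s.
  rewrite /block mul1n; apply: (zero_sum_bound_expn (prime_gt0 p_pr) bp).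
  have : b * p ^ a <= (k.+1 + r) * p ^ a by rewrite leq_mul2r bk orbT.
  by rewrite -{1}(prednK q_gt0) mulnS; lia.
have /bu[_] : block p a v k u by apply: sk; move: les; rewrite su; lia.
by rewrite addn1.
Qed.

Lemma not_uniq_map_pair (T U : eqType) (f : T -> U) (s : seq T) :
  ~~ uniq (map f s) -> exists x y, subseq [:: x; y] s /\ f x = f y.
Proof.
elim: s => //= x s IH; rewrite negb_and negbK => /orP[/mapP[y ys fxy]|/IH[y [z [yzs fyz]]]].
  by exists x, y; rewrite eqxx sub1seq.
by exists y, z; split=> //; exact: subseq_trans yzs (subseq_cons _ _).
Qed.

Lemma zero_sum_bound2 r : zero_sum_bound r 2 2 (2 ^ r * 2.-1).+1.
Proof.
move=> V v s; rewrite muln1 => les.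
pose f x := [ffun j : 'I_r => odd (v j x)].
have [|x [y [xys fxy]]] := @not_uniq_map_pair _ _ f s.
  apply: contraL les => /card_uniqP; rewrite size_map => <-.
  by rewrite -leqNgt (leq_trans (max_card _)) // card_ffun card_bool card_ord.
exists [:: x; y]; split=> // j; rewrite big_cons big_seq1 dvdn2 oddD.
by have /ffunP/(_ j) := fxy; rewrite !ffunE => ->; rewrite addbb.
Qed.

(** * Cap sets *)

Section CapSets.
Local Notation K := 'F_3.

Definition dot r (f x : 'rV[K]_r) : K := (\sum_i f ord0 i * x ord0 i)%R.

(** Over F_3, x + y + z = 0 means that x, y, z are equal or are the three points of a line. As x = y
    forces z = x, exactly the lines are excluded. *)
Definition cap r (A : {set 'rV[K]_r}) := forall x y z,
  x \in A -> y \in A -> z \in A -> (x + y + z = 0)%R -> x = y.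

Lemma dotD r (f x y : 'rV[K]_r) : dot f (x + y)%R = (dot f x + dot f y)%R.
Proof. by rewrite -big_split; apply: eq_bigr => i _; rewrite mxE mulrDr. Qed.

Lemma dotB r (f x y : 'rV[K]_r) : dot f (x - y)%R = (dot f x - dot f y)%R.
Proof.
by have := dotD f (x - y)%R y; rewrite subrK => ->; rewrite addrK.
Qed.

Lemma dot0l r (x : 'rV[K]_r) : dot 0%R x = 0%R.
Proof. by rewrite /dot big1 // => i _; rewrite mxE mul0r. Qed.

Lemma rowV_neq0P r (x : 'rV[K]_r) : x != 0%R -> exists i, x ord0 i != 0%R.
Proof.
move=> x0; apply: contrapT => none; case/eqP: x0; apply/rowP => i; rewrite mxE.
by apply/eqP/negPn/negP => xi; apply: none; exists i.
Qed.

Lemma card_dot_eq0 r (x : 'rV[K]_r.+1) : x != 0%R ->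
  #|[set f : 'rV[K]_r.+1 | dot f x == 0%R]| = 3 ^ r.
Proof.
move=> /rowV_neq0P[i xi].
have cardc c : #|[set f : 'rV[K]_r.+1 | dot f x == c]| =
    #|[set f : 'rV[K]_r.+1 | dot f x == 0%R]|.
  pose e : 'rV[K]_r.+1 := ((c / x ord0 i) *: delta_mx ord0 i)%R.
  have dot_e f : dot (f + e)%R x = (dot f x + c)%R.
    rewrite /dot (eq_bigr (fun j => f ord0 j * x ord0 j + e ord0 j * x ord0 j)%R).
      rewrite big_split /=; congr (_ + _)%R.
      rewrite (bigD1 i) //= big1 ?addr0 => [|j ji].
        by rewrite !mxE !eqxx mulr1 divfK.
      by rewrite !mxE (negPf ji) andbF mulr0 mul0r.
    by move=> j _; rewrite mxE mulrDl.
  rewrite -(card_imset [set f : 'rV[K]_r.+1 | dot f x == 0%R] (@addIr _ e)).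
  apply: eq_card => f; rewrite inE; apply/idP/imsetP => [fc|[g]].
    by exists (f - e)%R; rewrite ?subrK // inE -(inj_eq (@addIr _ c)) -dot_e subrK add0r.
  by rewrite inE => /eqP g0 ->; rewrite dot_e g0 add0r.
have : #|{: 'rV[K]_r.+1}| = 3 * #|[set f : 'rV[K]_r.+1 | dot f x == 0%R]|.
  rewrite -[LHS]sum1_card (partition_big (fun f => dot f x) xpredT) //=.
  rewrite (eq_bigr (fun=> #|[set f : 'rV[K]_r.+1 | dot f x == 0%R]|)) => [|c _].
    by rewrite sum_nat_const card_Fp.
  by rewrite sum1dep_card cardc.
by rewrite card_mx card_Fp // mul1n expnS => /eqP; rewrite eqn_pmul2l // => /eqP.
Qed.

Definition section_ r (A : {set 'rV[K]_r}) f c := [set x in A | dot f x == c].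

Lemma sum_section r (A : {set 'rV[K]_r}) f : \sum_c #|section_ A f c| = #|A|.
Proof.
rewrite -[RHS]sum1_card (partition_big (dot f) xpredT) //=.
by apply: eq_bigr => c _; rewrite -sum1_card; apply: eq_bigl => x; rewrite inE.
Qed.

(** Both sides count triples (f, x, y) with x, y in A and f x = f y. All 3^(r+1) functionals f serve
    a pair x = y; for x != y those vanishing on x - y form a hyperplane. *)
Lemma sum_section_sqr r (A : {set 'rV[K]_r.+1}) :
  \sum_f \sum_c #|section_ A f c| ^ 2 = #|A| * 3 ^ r.+1 + #|A| * #|A|.-1 * 3 ^ r.
Proof.
transitivity (\sum_(x in A) \sum_(y in A) #|[set f | dot f x == dot f y]|).
  transitivity (\sum_f \sum_(x in A) \sum_(y in A) (dot f x == dot f y)).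
    apply: eq_bigr => f _.
    transitivity (\sum_(x in A) #|section_ A f (dot f x)|).
      rewrite (partition_big (dot f) xpredT) //=; apply: eq_bigr => c _.
      rewrite (eq_bigr (fun=> #|section_ A f c|)) => [|x /andP[_ /eqP-> //]].
      rewrite sum_nat_const -mulnn; congr (_ * _).
      by apply: eq_card => x; rewrite inE.
    apply: eq_bigr => x _; rewrite -sum1_card.
    rewrite (eq_bigl (fun y => (y \in A) && (dot f x == dot f y))) => [|y].
      by rewrite big_mkcondr; apply: eq_bigr => y _; case: (_ == _).
    by rewrite inE eq_sym.
  rewrite exchange_big; apply: eq_bigr => x _; rewrite exchange_big; apply: eq_bigr => y _.
  by rewrite -sum1dep_card [RHS]big_mkcond; apply: eq_bigr => f _; case: (_ == _).
rewrite -[X in X * _ + _]sum1_card big_distrl /= -mulnA -[X in _ + X * _]sum1_card.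
rewrite big_distrl -big_split /=; apply: eq_bigr => x xA.
rewrite (bigD1 x) //= mul1n; congr (_ + _).
  by rewrite (eq_card (B := predT)) ?card_mx ?card_Fp ?mul1n // => f; rewrite inE eqxx.
rewrite (eq_bigr (fun=> 3 ^ r)) => [|y /andP[_ yx]].
  rewrite sum_nat_const mul1n; congr (_ * _).
  rewrite (cardsD1 x A) xA /=; apply: eq_card => y.
  by rewrite !inE andbC.
rewrite -(card_dot_eq0 (x := (x - y)%R)); last by rewrite subr_eq0 eq_sym.
by apply: eq_card => f; rewrite !inE dotB subr_eq0.
Qed.

(** Deleting a coordinate i with f_i != 0 is injective on the hyperplane f = c. It reflects lines: f
    takes the value 3 c = 0 at x + y + z, so this sum vanishes once its other coordinates do. *)
Lemma card_cap_section r m (A : {set 'rV[K]_r.+1}) f c :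
  (forall B : {set 'rV[K]_r}, cap B -> #|B| <= m) -> cap A -> f != 0%R ->
  #|section_ A f c| <= m.
Proof.
move=> capm capA /rowV_neq0P[i fi].
pose S := section_ A f c; pose g (x : 'rV[K]_r.+1) : 'rV[K]_r := col' i x.
have dotE x : dot f x = (f ord0 i * x ord0 i + \sum_j f ord0 (lift i j) * g x ord0 j)%R.
  by rewrite /dot (bigD1_ord i) //=; congr (_ + _)%R; apply: eq_bigr => j _; rewrite mxE.
have g_inj x y : dot f x = dot f y -> g x = g y -> x = y.
  move=> + gxy; rewrite !dotE gxy => /addIr /(mulfI fi) xy; apply/rowP => j.
  case: (unliftP i j) => [k ->|-> //].
  by move/rowP/(_ k): gxy; rewrite !mxE.
have gS_inj : {in S &, injective g}.
  by move=> x y; rewrite !inE => /andP[_ /eqP xc] /andP[_ /eqP yc]; apply: g_inj; rewrite xc.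
rewrite -(card_in_imset gS_inj); apply: capm => _ _ _ /imsetP[x xS ->]
  /imsetP[y yS ->] /imsetP[z zS ->] gxyz; congr g; move: xS yS zS; rewrite !inE.
move=> /andP[xA /eqP xc] /andP[yA /eqP yc] /andP[zA /eqP zc].
apply: (capA x y z) => //; apply: g_inj; last first.
  by move: gxyz; rewrite /g !raddfD /= raddf0.
rewrite !dotD xc yc zc /dot big1 => [|j _]; last by rewrite mxE mulr0.
rewrite -mulr2n -mulrSr -mulr_natr.
by rewrite (_ : 3%:R = 0 :> K)%R ?mulr0 //; apply/eqP; rewrite Fp_natr_eq0.
Qed.

(* Double counting of the pairs of points that lie in a common hyperplane of
   each of the parallel classes. *)
Lemma cap_lt r m N B (A : {set 'rV[K]_r.+1}) :
  (forall C : {set 'rV[K]_r}, cap C -> #|C| <= m) ->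
  (forall a b c, a <= m -> b <= m -> c <= m -> a + b + c = N ->
     a ^ 2 + b ^ 2 + c ^ 2 <= B) ->
  (3 ^ r.+1 - 1) * B + N ^ 2 < N * 3 ^ r.+1 + N * N.-1 * 3 ^ r ->
  cap A -> #|A| < N.
Proof.
move=> capm sqB ltN capA; rewrite ltnNge; apply/negP => leNA.
have [C [CA sC]] : exists C : {set 'rV[K]_r.+1}, C \subset A /\ #|C| = N.
  exists [set x in take N (enum A)]; split.
    by apply/fintype.subsetP => x; rewrite inE => /mem_take; rewrite mem_enum.
  rewrite cardsE (card_uniqP _) ?take_uniq ?enum_uniq //.
  by rewrite size_takel // -cardE.
have capC : cap C by move=> x y z /(fintype.subsetP CA) xA /(fintype.subsetP CA) yA /(fintype.subsetP CA); apply: capA.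
have := sum_section_sqr C; rewrite (bigD1 0%R) //= sC.
(* The functional f = 0 has all of C as its only nonempty section, and is counted apart. *)
have -> : \sum_c #|section_ C 0%R c| ^ 2 = N ^ 2.
  rewrite (bigD1 0%R) //= big1 ?addn0 => [|c c0].
    by rewrite -sC; congr (_ ^ _); apply: eq_card => x; rewrite inE dot0l eqxx andbT.
  by rewrite (eq_card0 (A := section_ C 0%R c)) // => x; rewrite inE dot0l eq_sym (negPf c0) andbF.
have leB : \sum_(f : 'rV[K]_r.+1 | f != 0%R) \sum_c #|section_ C f c| ^ 2 <=
    (3 ^ r.+1 - 1) * B.
  have <- : #|[pred f : 'rV[K]_r.+1 | f != 0%R]| = 3 ^ r.+1 - 1.
    have := cardC (pred1 (0%R : 'rV[K]_r.+1)).
    by rewrite card1 card_mx card_Fp // mul1n => <-; rewrite addKn.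
  rewrite -sum_nat_const; apply: leq_sum => f f0.
  have := sum_section C f; rewrite sC.
  have h c := card_cap_section c capm capC f0.
  rewrite !big_ord_recr !big_ord0 /= !add0n => sN.
  exact: sqB.
by move=> E; move: ltN; rewrite -E addnC ltn_add2l ltnNge leB.
Qed.

Lemma card_cap1 (A : {set 'rV[K]_1}) : cap A -> #|A| <= 2.
Proof.
move=> capA; rewrite leqNgt; apply/negP => A3.
have AT x : x \in A.
  suff -> : A = finset.setT by rewrite finset.in_setT.
  by apply/eqP; rewrite eqEcard finset.subsetT cardsT card_mx card_Fp.
have := capA 0%R (const_mx 1%R) (- const_mx 1%R)%R (AT _) (AT _) (AT _).
rewrite add0r subrr => /(_ erefl) /matrixP/(_ ord0 ord0); rewrite !mxE => /esym/eqP.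
by rewrite oner_eq0.
Qed.

(** The last argument of [cap_lt] is the sum of squares for the most uneven split of N: 9 = 2^2 +
    2^2 + 1^2 here, then 36 = 4^2 + 4^2 + 2^2 and 198 = 9^2 + 9^2 + 6^2. *)
Lemma card_cap2 (A : {set 'rV[K]_2}) : cap A -> #|A| <= 4.
Proof.
move=> capA; rewrite -ltnS; apply: (@cap_lt 1 2 5 9) => //; first exact: card_cap1.
by move=> [|[|[|a]]] [|[|[|b]]] [|[|[|c]]].
Qed.

Lemma card_cap3 (A : {set 'rV[K]_3}) : cap A -> #|A| <= 9.
Proof.
move=> capA; rewrite -ltnS; apply: (@cap_lt 2 4 10 36) => //; first exact: card_cap2.
by move=> [|[|[|[|[|a]]]]] [|[|[|[|[|b]]]]] [|[|[|[|[|c]]]]].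
Qed.

(* The maximum is 20, but sharp4 only needs 23. *)
Lemma card_cap4 (A : {set 'rV[K]_4}) : cap A -> #|A| <= 23.
Proof.
move=> capA; rewrite -ltnS; apply: (@cap_lt 3 9 24 198) => //; first exact: card_cap3.
move=> a b c a9 b9 c9 abc; rewrite !expnS !expn0 !muln1; nia.
Qed.


End CapSets.

(** * Rank three and four, all primes *)

Lemma size_sum_count (T : finType) (s : seq T) : size s = \sum_x count_mem x s.
Proof.
elim: s => [|x s IH] /=; first by rewrite big1.
by rewrite big_split /= -IH (bigD1 x) //= eqxx big1 // => y; rewrite eq_sym => /negPf->.
Qed.

(** Among 2 b + 1 vectors some value occurs three times, or more than b values occur and their set
    is not a cap. In the latter case a solution of x + y + z = 0 with x != y has three distinct
    terms. *)
Lemma zero_sum_bound3 r b :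
  (forall A : {set 'rV['F_3]_r}, cap A -> #|A| <= b) ->
  zero_sum_bound r 3 3 (b * 3.-1).+1.
Proof.
move=> capb V v s les.
pose f x : 'rV['F_3]_r := (\row_j (v j x)%:R)%R.
suff [t [t3 zt ct]] : exists t : seq 'rV['F_3]_r, [/\ size t = 3,
    (\sum_(x <- t) x = 0)%R & forall x, count_mem x t <= count_mem x (map f s)].
  have /count_subseqP[t' /subseq_map_lift[s' s's ->] tt'] := ct.
  exists s'; split=> //; first by rewrite -t3 (perm_size tt') size_map.
  move=> j; rewrite -(@Fp_natr_eq0 3) // natr_sum; apply/eqP.
  transitivity ((\sum_(x <- s') f x)%R ord0 j).
    by rewrite summxE; apply: eq_bigr => x _; rewrite mxE.
  by rewrite -(big_map f xpredT id) -(perm_big _ tt') zt mxE.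
have mul3 (x : 'rV['F_3]_r) : (x *+ 3 = 0)%R.
  apply/rowP => j; rewrite mulmxnE mxE -mulr_natr.
  by rewrite (_ : 3%:R = 0 :> 'F_3)%R ?mulr0 //; apply/eqP; rewrite Fp_natr_eq0.
have [[x cx]|no3] := pselect (exists x, 3 <= count_mem x (map f s)).
  exists (nseq 3 x); split=> [||y]; first by rewrite size_nseq.
    by rewrite big_nseq -Monoid.iteropE; apply: mul3.
  by rewrite count_nseq /=; case: eqP => [<-|_]; rewrite ?mul1n ?mul0n.
pose A := [set x in map f s].
have : ~ cap A.
  move=> /capb; apply/negP; rewrite -ltnNge -(@ltn_pmul2r 2) //.
  apply: leq_trans les _; rewrite -(size_map f) size_sum_count (bigID (mem A)) /=.
  rewrite [X in _ + X]big1 ?addn0 => [|x]; last by rewrite inE => /count_memPn.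
  rewrite -sum_nat_const; apply: leq_sum => x _.
  by rewrite leqNgt; apply/negP => x3; apply: no3; exists x.
move=> ncap; apply: contrapT => none; apply: ncap => x y z.
rewrite !inE => xs ys zs xyz; apply/eqP/negPn/negP => xy; apply: none.
exists [:: x; y; z]; split=> //; first by rewrite !big_cons big_nil addr0 addrA.
have zE : z = (- (x + y))%R by apply/eqP; rewrite eq_sym -subr_eq0 -opprD oppr_eq0 xyz.
have yx3 (u w : 'rV['F_3]_r) : (u + w + u = 0)%R -> u = w.
  have uu : (u + u = - u)%R.
    by apply/eqP; rewrite -addr_eq0 -addrA; apply/eqP/(mul3 u).
  by rewrite addrAC uu addrC => /subr0_eq.
have xz : x != z by apply: contraNneq xy => xz; apply/eqP/yx3; rewrite -[RHS]xyz -xz.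
have yz : y != z.
  by apply: contraNneq xy => yz; rewrite eq_sym; apply/eqP/yx3; rewrite -[RHS]xyz -yz (addrC y).
have [xl yl zl] : [/\ x \in map f s, y \in map f s & z \in map f s] by [].
move=> w; rewrite count_uniq_mem; last by rewrite /= !inE negb_or xy xz yz.
have [w_in|//] := boolP (w \in _); rewrite -has_count has_pred1.
by move: w_in; rewrite !inE => /or3P[] /eqP->.
Qed.

Section SmallPrimes.
Variables (p a : nat).
Hypothesis p_pr : prime p.

Lemma sharp3 (V : eqType) (v : 'I_3 -> V -> nat) k : 6 <= k -> sharp p a v k.
Proof.
have [p5|p5 k6] := leqP 5 p; first exact: sharp3_ge5.
have up b n : zero_sum_bound 3 p p (b * p.-1).+1 -> 3 < b -> b <= n + 4 ->
    n <= k -> sharp p a v n -> sharp p a v k.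
  move=> bp b3 bn nk sn; rewrite -(subnK nk); elim: (k - n) => [//|d IH].
  by rewrite addSn; apply: (sharp_succ p_pr _ bp) => //; lia.
have := p_pr; move: p5; case: p p_pr up => [|[|[|[|[|p']]]]] // p_pr' up _ _.
  (* For p = 2 the start is 4 = 2^2, with b = 2^3 = 4 + 4; for p = 3 it is 6 = 2 * 3, with b = 9 <=
     6 + 4. *)
  apply: (up _ 4 (@zero_sum_bound2 3)) => //; first by lia.
  by apply: (@sharp_pow 2 a 3 V v p_pr' _ 2).
apply: (up _ 6 (zero_sum_bound3 card_cap3)) => //.
change (sharp 3 a v (2 * 3)); apply: sharpM => //.
by apply: (@sharp_pow 3 a 3 V v p_pr' _ 1).
Qed.

Lemma sharp4 (V : eqType) (v : 'I_4 -> V -> nat) k : 18 <= k -> sharp p a v k.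
Proof.
have [p5|p5 k18] := leqP 5 p; first exact: sharp4_ge5.
have up b n : zero_sum_bound 4 p p (b * p.-1).+1 -> 4 < b -> b <= n + 5 ->
    n <= k -> sharp p a v n -> sharp p a v k.
  move=> bp b3 bn nk sn; rewrite -(subnK nk); elim: (k - n) => [//|d IH].
  by rewrite addSn; apply: (sharp_succ p_pr _ bp) => //; lia.
have := p_pr; move: p5; case: p p_pr up => [|[|[|[|[|p']]]]] // p_pr' up _ _.
  (* For p = 2 the start is 12 = 3 * 2^2, with b = 2^4 <= 12 + 5; for p = 3 it is 18 = 2 * 3^2, with
     b = 23 = 18 + 5. *)
  apply: (up _ 12 (@zero_sum_bound2 4)) => //; first by lia.
  change (sharp 2 a v (3 * 4)); apply: sharpM => //.
  by apply: (@sharp_pow 2 a 4 V v p_pr' _ 2).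
apply: (up _ 18 (zero_sum_bound3 card_cap4)) => //.
change (sharp 3 a v (2 * 9)); apply: sharpM => //.
by apply: (@sharp_pow 3 a 4 V v p_pr' _ 2).
Qed.

End SmallPrimes.

(** * Transfer to C_n^r *)

Lemma val_sum_Zp n (I : Type) (s : seq I) (F : I -> 'I_n.+1) :
  (\sum_(i <- s) F i)%R = (\sum_(i <- s) F i) %% n.+1 :> nat.
Proof.
elim: s => [|i s IH]; first by rewrite !big_nil mod0n.
by rewrite !big_cons /= IH modnDmr.
Qed.

Lemma sum_Zp_eq0 n (I : Type) (s : seq I) (F : I -> 'I_n.-1.+1) : 0 < n ->
  (\sum_(i <- s) F i)%R = 0%R <-> n %| \sum_(i <- s) F i.
Proof.
case: n F => // n F _; split=> [/(congr1 (@nat_of_ord _))|/eqP sF].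
  by rewrite val_sum_Zp => /eqP.
by apply: ord_inj; rewrite val_sum_Zp.
Qed.

Lemma s_Cpow_le n r L t : 0 < n -> 0 < t -> zero_sum_bound r n L t ->
  s_ L (Cpow n r) <= t.
Proof.
move=> n_gt0 t_gt0 bt; have bd : zs_bound L (Cpow n r) t.
  split=> // S les.
  have [T [TS TL zT]] := bt _ (fun j (x : Cpow n r) => val (x ord0 j)) S les.
  exists T; split=> //; apply/rowP => j; rewrite summxE mxE.
  by apply/sum_Zp_eq0; last exact: zT.
by have [_] := leastP (ex_intro _ t bd); apply.
Qed.

Lemma Cpow_zero_sum_bound n r L : 0 < n -> 0 < L ->
  (exponent [set: Cpow n r]%SET %| L) ->
  zero_sum_bound r n L (s_ L (Cpow n r)).
Proof.
move=> n_gt0 L_gt0 eL V v s les.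
have [[_ bL] _] := leastP (zs_bound_neq0 L_gt0 eL).
pose f x : Cpow n r := (\row_j inZp (v j x))%R.
have [|T [/subseq_map_lift[t ts ->] TL zT]] := bL (map f s); first by rewrite size_map.
exists t; split=> //; first by rewrite -TL size_map.
move=> j; have /rowP/(_ j) := zT; rewrite big_map summxE mxE => /(sum_Zp_eq0 _ _ n_gt0).
under eq_bigr do rewrite mxE /= prednK //.
by rewrite /dvdn modn_summ.
Qed.

(** [zero_sum_boundM] with t2 = (k + r) q - r. The saving m r stands on the left to avoid truncated
    subtraction; it produces the - r in the constant a_r. *)
Lemma s_mul_le p a r k m : prime p -> 0 < r -> 0 < k -> 0 < m ->
  (forall (V : eqType) (v : 'I_r -> V -> nat), sharp p a v k) ->
  s_ (k * (m * p ^ a)) (Cpow (m * p ^ a) r) + m * r <=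
    (k + r) * (m * p ^ a) + s_exp (Cpow m r).
Proof.
move=> p_pr r_gt0 k_gt0 m_gt0 sk; set q := p ^ a.
have q_gt0 : 0 < q by rewrite expn_gt0 prime_gt0.
have b1 : zero_sum_bound r m m (s_exp (Cpow m r)).
  by rewrite /s_exp exponent_Cpow //; apply: Cpow_zero_sum_bound; rewrite ?exponent_Cpow.
have s_gt0 : 0 < s_exp (Cpow m r).
  rewrite /s_exp exponent_Cpow //.
  have [|[]] := leastP (@zs_bound_neq0 m (Cpow m r) m_gt0 _) => //.
  by rewrite exponent_Cpow.
have rq : r <= r * q by rewrite leq_pmulr.
have kq : 0 < k * q by rewrite muln_gt0 k_gt0.
have b2 : zero_sum_bound r q (k * q) ((k + r) * q - r).
  by move=> V v s les; apply: sk; rewrite -/q; move: les; lia.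
have t2_gt0 : 0 < (k + r) * q - r by rewrite mulnDl; lia.
have := s_Cpow_le _ _ (zero_sum_boundM m_gt0 t2_gt0 b1 b2).
rewrite -mulnA [q * m]mulnC muln_gt0 m_gt0 q_gt0 addn_gt0 s_gt0 orbT => /(_ isT isT) les.
apply: leq_trans (leq_add les (leqnn _)) _; rewrite addnAC leq_add2r -mulnDr.
rewrite [leqRHS]mulnCA leq_mul2l; apply/orP; right.
by rewrite mulnDl; lia.
Qed.

(** * Counting smooth numbers *)

Definition smooth Y n := all (fun p => p <= Y) (primes n).

Definition count_smooth N Y := count (smooth Y) (iota 1 N).

(** Numbers not divisible by Y + 1 are Y-smooth; the others are (Y + 1) m with m smooth. Prime and
    composite Y + 1 are treated alike, so the product in [count_smooth_le] runs over all
    integers. *)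
Lemma count_smoothS N Y :
  count_smooth N Y.+1 <= count_smooth N Y + count_smooth (N %/ Y.+1) Y.+1.
Proof.
set A := [seq n <- iota 1 N | smooth Y n].
set B := [seq Y.+1 * n | n <- [seq n <- iota 1 (N %/ Y.+1) | smooth Y.+1 n]].
have -> : count_smooth N Y + count_smooth (N %/ Y.+1) Y.+1 = size (A ++ B).
  by rewrite size_cat size_map !size_filter.
rewrite /count_smooth -size_filter; apply: uniq_leq_size.
  exact/filter_uniq/iota_uniq.
move=> n; rewrite mem_cat !mem_filter mem_iota add1n ltnS => /and3P[/allP smn n_gt0 nN].
have [/dvdnP[m nE]|ndvd] := boolP (Y.+1 %| n).
  apply/orP; right; apply/mapP; exists m; last by rewrite mulnC.
  have m_gt0 : 0 < m by move: n_gt0; rewrite nE; case: m {nE}.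
  rewrite mem_filter mem_iota m_gt0 add1n ltnS leq_divRL // -nE nN !andbT.
  by apply/allP => p pm; apply: smn; rewrite nE primesM // pm.
apply/orP; left; rewrite n_gt0 nN !andbT; apply/allP => p pn.
rewrite -ltnS ltn_neqAle smn // andbT; apply: contraNneq ndvd => <-.
by move: pn; rewrite mem_primes => /and3P[].
Qed.

Lemma count_smooth1 N : count_smooth N 1 <= 1.
Proof.
rewrite /count_smooth -size_filter; apply: (@uniq_leq_size _ _ [:: 1]).
  exact/filter_uniq/iota_uniq.
move=> n; rewrite mem_filter mem_iota inE => /and3P[/allP smn n_gt0 _].
have [n2|] := ltnP 1 n; last by rewrite eqn_leq n_gt0 => ->.
have : pdiv n <= 1 by apply: smn; rewrite mem_primes pdiv_prime // n_gt0 pdiv_dvd.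
by rewrite leqNgt prime_gt1 // pdiv_prime.
Qed.

Section SmoothBound.
Variable R : realType.
Local Open Scope ring_scope.

(* Rankin's method, by induction on the recurrence count_smoothS. *)
Lemma count_smooth_le (s : R) N Y : 0 < s ->
  (count_smooth N Y.+1)%:R <=
    N%:R `^ s * \prod_(i < Y) (1 - i.+2%:R `^ (- s))^-1.
Proof.
have pow1 : 1 `^ s = 1 :> R by rewrite powR1.
move=> s_gt0; elim: Y N => [|Y IHY] N.
  rewrite big_ord0 mulr1; case: N => [|N]; first by rewrite powR_ge0.
  apply: (@le_trans _ _ 1); first by rewrite (ler_nat R _ 1); apply: count_smooth1.
  by rewrite -[leLHS]pow1; apply: ge0_ler_powR; rewrite ?(ltW s_gt0) ?nnegrE ?ler1n.
have factor_gt0 i : 0 < 1 - i.+2%:R `^ (- s) :> R.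
  by rewrite subr_gt0 powRN invf_lt1 ?powR_gt0 // -[ltLHS]pow1 gt0_ltr_powR ?nnegrE // ltr1n.
have prod_ge0 Z : 0 <= \prod_(i < Z) (1 - i.+2%:R `^ (- s))^-1 :> R.
  by apply: prodr_ge0 => i _; rewrite invr_ge0 ltW.
elim/ltn_ind: N => N IHN.
have [->|N_gt0] := posnP N; first by rewrite mulr_ge0 ?powR_ge0.
have N'N : (N %/ Y.+2 < N)%N by rewrite ltn_Pdiv.
apply: le_trans (_ : _ <= (count_smooth N Y.+1 + count_smooth (N %/ Y.+2) Y.+2)%:R) _.
  by rewrite ler_nat; apply: count_smoothS.
rewrite natrD; apply: le_trans (lerD (IHY N) (IHN _ N'N)) _.
rewrite big_ord_recr /=; move: (prod_ge0 Y) (factor_gt0 Y).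
set P := \prod_(i < Y) _; set w := _ `^ (- s); set Ns := N%:R `^ s => P_ge0 w_lt1.
have N'w : (N %/ Y.+2)%:R `^ s <= Ns * w.
  have -> : w = (Y.+2%:R^-1) `^ s by rewrite -powR_inv1 // -powRrM mulN1r.
  rewrite -powRM ?invr_ge0 //; apply: ge0_ler_powR; rewrite ?(ltW s_gt0) ?nnegrE ?divr_ge0 //.
  by rewrite ler_pdivlMr // -natrM ler_nat leq_divM.
(* The two terms add up to exactly Ns P / (1 - w). *)
apply: le_trans (_ : Ns * P + Ns * w * (P / (1 - w)) <= _).
  by rewrite lerD2l ler_wpM2r // mulr_ge0 // invr_ge0 ltW.
rewrite le_eqVlt; apply/orP; left; apply/eqP.
by field; rewrite gt_eqF.
Qed.

(* The mean value inequality for x `^ t, up to a factor 2. *)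
Lemma powR_pred_le (t x : R) : 0 < t < 1 -> 2 <= x ->
  x `^ (t - 1) <= 2 / t * (x `^ t - (x - 1) `^ t).
Proof.
move=> /andP[t0 t1] x2.
have x_gt0 : 0 < x by lra.
have x1_gt0 : 0 < x - 1 by lra.
set u := t / x.
have u0 : 0 < u by rewrite divr_gt0.
have u1 : u <= 1 by rewrite ler_pdivrMr //; lra.
have lnx1 : ln (x - 1) <= ln x - x^-1.
  have -> : x - 1 = x * (1 + - x^-1) by field; rewrite gt_eqF.
  have xV : x^-1 < 1 by rewrite invf_lt1 //; lra.
  rewrite lnM ?posrE //; last by lra.
  by rewrite lerD2l; apply: le_ln1Dx; lra.
have expu : expR (- u) <= 1 - u / 2.
  rewrite expRN invf_ple ?posrE ?expR_gt0 //; last by lra.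
  apply: le_trans (expR_ge1Dx u); rewrite -[_^-1]mul1r ler_pdivrMr; last by lra.
  nra.
have le1 : (x - 1) `^ t <= x `^ t * (1 - u / 2).
  apply: le_trans (_ : x `^ t * expR (- u) <= _); last by rewrite ler_wpM2l // powR_ge0.
  rewrite /powR !gt_eqF // -expRD ler_expR /u; nra.
have -> : x `^ (t - 1) = x `^ t / x.
  by rewrite powRB ?(gt_eqF x_gt0) ?implybT // powRr1 // ltW.
have -> : x `^ t / x = 2 / t * (x `^ t * (u / 2)) by rewrite /u; field; rewrite !gt_eqF.
rewrite ler_wpM2l //; first by rewrite divr_ge0 // ltW.
lra.
Qed.

(** With w = i^(-s), each factor is 1 + w / (1 - w) <= exp (D w), where D is the factor at i = 2.
    The sum of the w telescopes by [powR_pred_le] with t = 1 - s. *)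
Lemma smooth_product_le (s : R) : 0 < s < 1 -> exists2 C : R, 0 < C &
  forall Y, \prod_(i < Y) (1 - i.+2%:R `^ (- s))^-1 <= expR (C * Y.+1%:R `^ (1 - s)).
Proof.
move=> /andP[s0 s1]; set t := 1 - s.
have t01 : 0 < t < 1 by rewrite /t; lra.
have pow1 : 1 `^ s = 1 :> R by rewrite powR1.
have w_lt1 i : i.+2%:R `^ (- s) < 1 :> R.
  by rewrite powRN invf_lt1 ?powR_gt0 // -[ltLHS]pow1 gt0_ltr_powR ?nnegrE // ltr1n.
pose D : R := (1 - 2 `^ (- s))^-1.
have D_gt0 : 0 < D by rewrite invr_gt0 subr_gt0 (w_lt1 0%N).
have [t0 t1] := andP t01.
have C_gt0 : 0 < D * (2 / t) by rewrite mulr_gt0 // divr_gt0.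
exists (D * (2 / t)) => // Y.
elim: Y => [|Y IH].
  rewrite big_ord0; apply: le_trans (expR_ge1Dx _); rewrite lerDl.
  by rewrite mulr_ge0 ?powR_ge0 // ltW.
rewrite big_ord_recr /=; set w := Y.+2%:R `^ _.
have w0 : 0 < w by rewrite powR_gt0.
have wle : w <= 2 `^ (- s).
  rewrite /w !powRN lef_pV2 ?posrE ?powR_gt0 //.
  by apply: ge0_ler_powR; rewrite ?(ltW s0) ?nnegrE // ler_nat.
have := w_lt1 Y; rewrite -/w => w1.
have factor_le : (1 - w)^-1 <= expR (D * w).
  apply: le_trans (_ : 1 + w / (1 - w) <= _).
    by rewrite le_eqVlt; apply/orP; left; apply/eqP; field; rewrite gt_eqF // subr_gt0.
  apply: le_trans (expR_ge1Dx _) _; rewrite ler_expR mulrC ler_wpM2r ?(ltW w0) //.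
  by rewrite lef_pV2 ?posrE ?subr_gt0 // ?(w_lt1 0%N) // lerD2l lerN2.
apply: le_trans (ler_pM _ _ IH factor_le) _.
- by apply: prodr_ge0 => i _; rewrite invr_ge0 subr_ge0 ltW.
- by rewrite invr_ge0 subr_ge0 ltW.
rewrite -expRD ler_expR -!mulrA -mulrDr ler_wpM2l ?(ltW D_gt0) //.
have := @powR_pred_le t Y.+2%:R t01.
rewrite ler_nat => /(_ isT); rewrite (_ : t - 1 = - s); last by rewrite /t; lra.
rewrite -/w (_ : Y.+2%:R - 1 = Y.+1%:R :> R); last by rewrite -[Y.+2]addn1 natrD addrK.
by rewrite mulrBr; lra.
Qed.

End SmoothBound.

(** * Exceptional integers *)

Section Final.
Variable R : realType.
Local Open Scope classical_set_scope.
Local Open Scope ring_scope.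

(** Makes a_r nonnegative. Listing each element of C_2^r once leaves no zero-sum pair, so 2 r <= 2^r
    < s(C_2^r), which is at most twice the constant. *)
Lemma AD_const_ge (c : R) r : alon_dubiner c -> (2 <= r)%N -> r%:R <= AD_const c r.
Proof.
move=> cAD r2; have r_gt0 : (0 < r)%N by exact: ltnW.
have lt_s : (2 ^ r < s_exp (Cpow 2 r))%N.
  rewrite ltnNge; apply/negP => les.
  have := Cpow_zero_sum_bound (n := 2) (r := r) (L := 2) isT isT.
  rewrite exponent_Cpow // => /(_ (dvdnn 2)).
  rewrite /s_exp exponent_Cpow // in les.
  pose v j (x : Cpow 2 r) : nat := x ord0 j.
  move=> /(_ _ v (enum (Cpow 2 r))) [|T [TS T2 zT]].
    by apply: leq_trans les _; rewrite -cardT card_mx card_ord mul1n.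
  have := subseq_uniq TS (enum_uniq _).
  case: T T2 zT {TS} => [|x [|y []]] //= _ zT; rewrite inE andbT => /negP; apply.
  apply/eqP/rowP => j; apply: ord_inj; have := zT j.
  rewrite big_cons big_seq1 /v.
  by case: (x ord0 j) => [[|[|]]] //= _; case: (y ord0 j) => [[|[|]]].
have := cAD 2 r isT r2; have : (r * 2 < s_exp (Cpow 2 r))%N.
  apply: leq_ltn_trans lt_s; elim: r r2 {r_gt0} => // [[|[|r]]] // IH _.
  by have := IH isT; rewrite [(2 ^ r.+3)%N]expnS; lia.
rewrite -(ltr_nat R) natrM; lra.
Qed.

Lemma mult_sharp k r n p a t (V : eqType) (v : 'I_r -> V -> nat) :
  [\/ (r = 3 /\ 6 <= k)%N, (r = 4 /\ 18 <= k)%N | (5 <= r /\ 0 < k)%N] ->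
  prime p -> (r <= p ^ t)%N -> ppow_ge n r = (p ^ t)%N ->
  sharp p a v (mult k r n).
Proof.
move=> H p_pr rt tE; case: H v => [[-> k6]|[-> k18]|[r5 k0]] v.
- exact: sharp3.
- exact: sharp4.
rewrite /mult ltnNge r5 /= tE; apply: sharpM => //; first by lia.
by apply: sharp_pow => //; lia.
Qed.

Lemma S_mem (c : R) k r n (x A : R) : alon_dubiner c ->
  [\/ (r = 3 /\ 6 <= k)%N, (r = 4 /\ 18 <= k)%N | (5 <= r /\ 0 < k)%N] ->
  (2 <= n)%N -> n%:R <= x -> ln n%:R `^ A <= (max_ppow n)%:R -> S_ c k r x A n.
Proof.
move=> cAD H n2 nx leM; split=> //.
have r2 : (2 <= r)%N by case: H => [] []; lia.
have n0 : (0 < n)%N by exact: ltnW.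
have [p [a [t [p_pr a0 ME t0 [tE rt _]]]]] := ppow_geP r n2.
have [/dvdnP[m nE] _ _] := max_ppowP n2.
have k0 : (0 < mult k r n)%N.
  have k_gt0 : (0 < k)%N by case: H => [] []; lia.
  by rewrite /mult; case: ifP => // _; rewrite muln_gt0 k_gt0 tE expn_gt0 prime_gt0.
have m0 : (0 < m)%N by move: n0; rewrite nE; case: (m).
have := s_mul_le (p := p) (a := a) (r := r) p_pr (ltnW r2) k0 m0
  (fun V v => mult_sharp v H p_pr rt tE).
rewrite -ME -nE -(ler_nat R) !natrD !natrM => les.
have sm := cAD m r m0 r2.
(* The error term is s(C_m^r) - m r <= a_r m, and m = n / M(n). *)
have qm : m%:R <= n%:R / ln n%:R `^ A.
  have L0 : 0 < ln n%:R `^ A by rewrite powR_gt0 // ln_gt0 // ltr1n.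
  by rewrite ler_pdivlMr // {2}nE natrM ler_wpM2l.
have a0' : 0 <= a_ c r by rewrite subr_ge0 AD_const_ge.
have := ler_wpM2l a0' qm.
have -> : a_ c r * m%:R = AD_const c r * m%:R - m%:R * r%:R by rewrite mulrBl [r%:R * _]mulrC.
by move: les; rewrite natrD; lra.
Qed.

Lemma Sbar_smooth (c : R) k r n (x A : R) : alon_dubiner c ->
  [\/ (r = 3 /\ 6 <= k)%N, (r = 4 /\ 18 <= k)%N | (5 <= r /\ 0 < k)%N] ->
  1 <= x -> 0 <= A -> Sbar c k r x A n ->
  (n \in iota 1 (Num.truncn x)) && smooth (Num.truncn (ln x `^ A)).+1 n.
Proof.
move=> cAD H x1 A0 [n0 nx nS].
rewrite mem_iota n0 add1n ltnS truncn_ge_nat ?nx; last exact: le_trans x1.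
apply/allP => p; rewrite mem_primes => /and3P[p_pr _ pn].
have n2 : (2 <= n)%N by apply: leq_trans (prime_gt1 p_pr) (dvdn_leq n0 pn).
have [_ _ maxM] := max_ppowP n2.
have pM : (p <= max_ppow n)%N by apply: maxM => //; exists p, 1%N.
apply: leqW; rewrite truncn_ge_nat ?powR_ge0 //; apply: (@le_trans _ _ (max_ppow n)%:R).
  by rewrite ler_nat.
have n_gt1 : (1 : R) < n%:R by rewrite ltr1n.
apply: (@le_trans _ _ (ln n%:R `^ A)).
  by rewrite leNgt; apply/negP => /ltW leM; apply: nS; apply: S_mem.
apply: ge0_ler_powR; rewrite ?nnegrE ?ln_ge0 // ?(ltW n_gt1) //.
by rewrite ler_ln ?posrE //; lra.
Qed.

Lemma card_Sbar_le (c : R) k r (x A : R) : alon_dubiner c ->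
  [\/ (r = 3 /\ 6 <= k)%N, (r = 4 /\ 18 <= k)%N | (5 <= r /\ 0 < k)%N] ->
  1 <= x -> 0 <= A -> card_Sbar c k r A x <=
    (count_smooth (Num.truncn x) (Num.truncn (ln x `^ A)).+1)%:R.
Proof.
move=> cAD H x1 A0; rewrite /card_Sbar ler_nat /count_smooth -size_filter.
apply: uniq_leq_size; first exact: finmap.fset_uniq.
move=> n; rewrite in_fset_set; last exact: finite_Sbar.
rewrite inE mem_filter andbC; exact: Sbar_smooth.
Qed.

Lemma count_smooth_log_le (A e : R) : 1 <= A -> 0 < e ->
  exists2 x0 : nat, (0 < x0)%N & forall x : R, x0%:R <= x ->
    (count_smooth (Num.truncn x) (Num.truncn (ln x `^ A)).+1)%:R <=
      x `^ (1 - 1 / A + e).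
Proof.
move=> A1 e0; have A0 : 0 < A by lra.
pose d := Num.min e (1 / (2 * A)).
have dA : d <= 1 / (2 * A) by rewrite /d ge_min lexx orbT.
have d0 : 0 < d by rewrite /d lt_min e0 divr_gt0 // mulr_gt0.
have de : d <= e by rewrite /d ge_min lexx.
have A2 : 1 / (2 * A) = 1 / A / 2 by field; rewrite gt_eqF.
have iA0 : 0 < 1 / A by rewrite divr_gt0.
have iA1 : 1 / A <= 1 by rewrite ler_pdivrMr // mul1r.
(* Half of d goes into Rankin's exponent and half absorbs the product. The cap 1 / (2 A) on d keeps
   s below 1. *)
set s := 1 - 1 / A + d / 2.
have s01 : 0 < s < 1 by rewrite /s; lra.
have [C C0 prodC] := smooth_product_le s01.
pose h := A * d / 2.
have h0 : 0 < h by rewrite /h divr_gt0 // mulr_gt0.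
(* Since A (1 - s) = 1 - h, the product is at most exp (2 C L^(1 - h)) with L = ln x; for L >= L0
   this exponent is at most (d / 2) L. *)
pose L0 := (4 * C / d) `^ (h^-1).
exists (Num.truncn (expR (1 + L0))).+1 => // x lex.
have L0x : expR (1 + L0) <= x.
  by apply: le_trans lex; apply/ltW/real_truncnS_gt/num_real.
have L00 : 0 <= L0 by rewrite powR_ge0.
have x0 : 0 < x by apply: lt_le_trans L0x; rewrite expR_gt0.
have lnx : 1 + L0 <= ln x by rewrite -[leLHS]expRK ler_ln ?posrE ?expR_gt0.
set L := ln x in lnx *.
have L_gt0 : 0 < L by lra.
have x1 : 1 <= x.
  by apply: le_trans L0x; apply: le_trans (expR_ge1Dx _); lra.
set y := L `^ A.
have y1 : 1 <= y.
  rewrite /y -[leLHS](powRr0 L); apply: ler_powR; lra.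
have Yle : (Num.truncn y).+1%:R <= 2 * y.
  have le_y : (Num.truncn y)%:R <= y by rewrite truncn_le; lra.
  by rewrite -addn1 natrD; lra.
set t := 1 - s in prodC.
have At : A * t = 1 - h by rewrite /t /s /h; field; rewrite gt_eqF.
have t01 : 0 < t < 1 by rewrite /t; lra.
have [t0 t1] := andP t01.
have Yt : (Num.truncn y).+1%:R `^ t <= 2 * L `^ (1 - h).
  apply: (@le_trans _ _ ((2 * y) `^ t)).
    by apply: ge0_ler_powR; rewrite ?(ltW t0) ?nnegrE // mulr_ge0 // powR_ge0.
  rewrite powRM ?powR_ge0 // /y -powRrM At ler_wpM2r ?powR_ge0 //.
  by apply: ler1_powR; lra.
have CL : 4 * C / d <= L `^ h.
  have CD0 : 0 <= 4 * C / d by rewrite divr_ge0 ?mulr_ge0 ?ltW.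
  have -> : 4 * C / d = L0 `^ h by rewrite /L0 -powRrM mulVf ?gt_eqF // powRr1.
  by apply: ge0_ler_powR; rewrite ?(ltW h0) ?nnegrE //; lra.
have CLh : C * (2 * L `^ (1 - h)) <= d / 2 * L.
  have LE : L `^ (1 - h) * L `^ h = L.
    by rewrite -powRD ?subrK ?powRr1 ?ltW // (gt_eqF L_gt0) implybT.
  have -> : C * (2 * L `^ (1 - h)) = d / 2 * (L `^ (1 - h) * (4 * C / d)).
    by field; rewrite gt_eqF.
  by rewrite -{2}LE ler_wpM2l ?divr_ge0 ?(ltW d0) // ler_wpM2l // powR_ge0.
have [s0 _] := andP s01.
apply: le_trans (count_smooth_le _ _ s0) _.
apply: (@le_trans _ _ (x `^ s * expR (d / 2 * L))).
  apply: ler_pM; rewrite ?powR_ge0 //.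
  - apply: prodr_ge0 => i _; rewrite invr_ge0 subr_ge0 powRN.
    rewrite invf_le1 ?powR_gt0 // -[leLHS](powRr0 i.+2%:R).
    by apply: ler_powR; rewrite ?ler1n // ltW.
  - apply: ge0_ler_powR; rewrite ?(ltW s0) ?nnegrE ?(ltW x0) // truncn_le; exact: ltW.
  apply: le_trans (prodC _) _; rewrite ler_expR; apply: le_trans CLh.
  by rewrite ler_wpM2l // ltW.
have -> : expR (d / 2 * L) = x `^ (d / 2) by rewrite /powR gt_eqF.
rewrite -powRD ?(gt_eqF x0) ?implybT //; apply: ler_powR => //.
by rewrite /s; lra.
Qed.

(** The bound on smooth numbers involves neither k nor r, so one threshold serves all of them, with
    implied constant 1. *)
Lemma card_Sbar_powR (c A e : R) : alon_dubiner c -> 1 <= A -> 0 < e ->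
  exists2 x0 : nat, (0 < x0)%N & forall k r,
    [\/ (r = 3 /\ 6 <= k)%N, (r = 4 /\ 18 <= k)%N | (5 <= r /\ 0 < k)%N] ->
    forall x : R, x0%:R <= x -> card_Sbar c k r A x <= x `^ (1 - 1 / A + e).
Proof.
move=> cAD A1 e0; have [x0 x0_gt0 le_x0] := count_smooth_log_le A1 e0.
exists x0 => // k r H x x0x; apply: le_trans (le_x0 x x0x).
by apply: card_Sbar_le => //; [apply: le_trans x0x; rewrite ler1n|lra].
Qed.

Lemma card_Sbar_density (c A : R) k r : alon_dubiner c -> 1 <= A ->
  [\/ (r = 3 /\ 6 <= k)%N, (r = 4 /\ 18 <= k)%N | (5 <= r /\ 0 < k)%N] ->
  card_Sbar c k r A x / x @[x --> +oo] --> (0 : R).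
Proof.
move=> cAD A1 H; have A0 : 0 < A by lra.
(* Taking epsilon = 1 / (2 A) bounds the density by x^(-b), which tends to 0. *)
pose b := 1 / A / 2.
have b0 : 0 < b by rewrite !divr_gt0.
have [x0 _ /(_ k r H) le_x0] := card_Sbar_powR cAD A1 b0.
apply/cvgr0Pnorm_le => e e0; near=> x.
have x_gt0 : 0 < x by near: x; apply: nbhs_pinfty_gt; rewrite num_real.
rewrite ger0_norm; last by rewrite divr_ge0 ?ler0n // ltW.
rewrite ler_pdivrMr //; apply: le_trans (le_x0 x _) _.
  by near: x; apply: nbhs_pinfty_ge; rewrite num_real.
have -> : 1 - 1 / A + b = 1 - b by rewrite /b; lra.
rewrite powRB ?(gt_eqF x_gt0) ?implybT // powRr1 ?(ltW x_gt0) //.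
rewrite mulrC ler_wpM2r ?(ltW x_gt0) // -[leRHS]invrK lef_pV2 ?posrE ?powR_gt0 ?invr_gt0 //.
have -> : e^-1 = (e^-1 `^ b^-1) `^ b.
  by rewrite -powRrM mulVf ?gt_eqF // powRr1 // invr_ge0 ltW.
apply: ge0_ler_powR; rewrite ?(ltW b0) ?nnegrE ?powR_ge0 ?(ltW x_gt0) //.
Unshelve. all: by end_near. Qed.

End Final.

Local Open Scope classical_set_scope.
Local Open Scope ring_scope.

Theorem theorem4p2 (R : realType) (c : R) (c_gt0 : 0 < c)
    (c_AD : alon_dubiner c) (A epsilon : R) (A_ge1 : 1 <= A)
    (epsilon_gt0 : 0 < epsilon) :
  let g := fun x : R => x `^ (1 - 1 / A + epsilon) in
  [/\ exists2 M : R, 0 < M & forall k : nat, (6 <= k)%N ->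
        eventually_le M (card_Sbar c k 3 A) g,
      exists2 M : R, 0 < M & forall k : nat, (18 <= k)%N ->
        eventually_le M (card_Sbar c k 4 A) g &
      exists2 M : R, 0 < M & forall r k : nat, (5 <= r)%N -> (0 < k)%N ->
        eventually_le M (card_Sbar c k r A) g]
  /\
  [/\ forall k : nat, (6 <= k)%N ->
        card_Sbar c k 3 A x / x @[x --> +oo] --> (0 : R),
      forall k : nat, (18 <= k)%N ->
        card_Sbar c k 4 A x / x @[x --> +oo] --> (0 : R) &
      forall r k : nat, (5 <= r)%N -> (0 < k)%N ->
        card_Sbar c k r A x / x @[x --> +oo] --> (0 : R)].
Proof.
move=> g; have [x0 x0_gt0 le_x0] := card_Sbar_powR c_AD A_ge1 epsilon_gt0.
have le_g k r :
    [\/ (r = 3 /\ 6 <= k)%N, (r = 4 /\ 18 <= k)%N | (5 <= r /\ 0 < k)%N] ->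
    eventually_le 1 (card_Sbar c k r A) g.
  move=> H; exists x0 => // x x0x; rewrite mul1r !ger0_norm ?powR_ge0 ?ler0n //.
  exact: le_x0.
split; split.
- by exists 1 => // k k6; apply: le_g; constructor 1.
- by exists 1 => // k k18; apply: le_g; constructor 2.
- by exists 1 => // r k r5 k0; apply: le_g; constructor 3.
- by move=> k k6; apply: card_Sbar_density => //; constructor 1.
- by move=> k k18; apply: card_Sbar_density => //; constructor 2.
- by move=> r k r5 k0; apply: card_Sbar_density => //; constructor 3.
Qed.
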